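(* Let $(X_n)_{n\ge 1}$ be an associated sequence of mean-zero, square-integrable random variables defined on the same probability space $(\Omega,\mathcal{A},\mathbb{P})$, and put $S_0=0$, $S_n=X_1+\cdots+X_n$ and $s_n^2=\mathrm{Var}(S_n)$. Let $(\ell(n))_{n\ge1}$ be a sequence of positive integers and write $n=m(n)\ell(n)+r(n)$ with integers $m(n)\ge0$ and $0\le r(n)<\ell(n)$. For each $n$ and each $j\in\{1,\dots,m(n)\}$ put $$\tau_j^2=\mathrm{Var}\left(S_{j\ell(n)}-S_{(j-1)\ell(n)}\right)=\mathbb{E}\left(S_{j\ell(n)}-S_{(j-1)\ell(n)}\right)^2,\qquad \nu_{m(n)}^2=\tau_1^2+\cdots+\tau_{m(n)}^2 .$$ Assume that, as $n\to+\infty$: - $m(n)\to+\infty$, $\ell(n)/n\to0$ and $r(n)/n\to0$; - $\dfrac{\ell(n)}{s_n^2}\displaystyle\sum_{j=1}^{m(n)}\mathrm{Var}\left(\frac{S_{j\ell(n)}-S_{(j-1)\ell(n)}}{\sqrt{\ell(n)}}\right)\to 1$; - at least one of the following two conditions holds: $$\frac{1}{s_n^2}\mathrm{Var}\left(\sum_{i=m(n)\ell(n)+1}^{n}X_i\right)\to 0,$$ or $$\sup_{1\le j\le m(n)+1}\frac{\ell(n)}{s_n^2}\mathrm{Var}\left(\frac{S_{j\ell(n)}-S_{(j-1)\ell(n)}}{\sqrt{\ell(n)}}\right)\to 0 .$$ Then the two conditions $$\max_{1\le j\le m(n)}\frac{\mathbb{E}\left(S_{j\ell(n)}-S_{(j-1)\ell(n)}\right)^2}{s_n^2}\to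 0\quad\text{and}\quad \frac{S_n}{s_n}\ \text{converges weakly to}\ \mathcal{N}(0,1)\qquad (n\to+\infty)$$ hold together if and only if for every $\varepsilon>0$, $$\frac{1}{s_n^2}\sum_{j=1}^{m(n)}\mathbb{E}\left(\left(S_{j\ell(n)}-S_{(j-1)\ell(n)}\right)^2\mathbf{1}_{\left\{|S_{j\ell(n)}-S_{(j-1)\ell(n)}|\ge\varepsilon\nu_{m(n)}\right\}}\right)\to0\quad\text{as } n\to+\infty .$$ Moreover, in this last condition $\nu_{m(n)}$ may be replaced by $s_n$; that is, the equivalence also holds with the condition that for every $\varepsilon>0$, $$\frac{1}{s_n^2}\sum_{j=1}^{m(n)}\mathbb{E}\left(\left(S_{j\ell(n)}-S_{(j-1)\ell(n)}\right)^2\mathbf{1}_{\left\{|S_{j\ell(n)}-S_{(j-1)\ell(n)}|\ge\varepsilon s_n\right\}}\right)\to0\quad\text{as } n\to+\infty .$$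
   Context: A finite family $(X_1,\dots,X_n)$ of real random variables is associated if for any two real-valued coordinate-wise non-decreasing functions $h,g$ on $\mathbb{R}^n$ one has $\mathrm{Cov}(h(X_1,\dots,X_n),g(X_1,\dots,X_n))\ge 0$ whenever this covariance exists. An infinite sequence is associated if all its finite subfamilies are associated. $s_n$ and $\nu_{m(n)}$ are the nonnegative square roots of $s_n^2$ and $\nu_{m(n)}^2$; $s_n>0$ for all large $n$ (implicit in dividing by $s_n$). The quantities $\tau_j$ depend on $n$ through $\ell(n)$. $\mathcal{N}(0,1)$ is the standard normal law. *)

(* Defs.v *)
From HB Require Import structures.
From mathcomp Require Import all_boot all_order all_algebra.
From mathcomp Require Import all_classical all_reals all_analysis.

Set Implicit Arguments.
Unset Strict Implicit.
Unset Printing Implicit Defensive.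

Import Order.TTheory GRing.Theory Num.Theory.
Import numFieldNormedType.Exports.

Local Open Scope classical_set_scope.
Local Open Scope ring_scope.

Section Definitions.
Context (d : measure_display) (T : measurableType d) (R : realType).
Variable P : probability T R.

Definition coordinatewise_nondecreasing (k : nat) (h : 'rV[R]_k -> R) : Prop :=
  forall x y : 'rV[R]_k, (forall i, x ord0 i <= y ord0 i) -> h x <= h y.

Definition integrableRV (Y : T -> R) : Prop := P.-integrable setT (EFin \o Y).

(* Integrability contains measurability of the functions of X with respect to
   the sigma-algebra of T, so h and g are not required to be Borel. *)
Definition covariance_exists (Y Z : T -> R) : Prop :=
  [/\ integrableRV Y, integrableRV Z & integrableRV (fun w => Y w * Z w)].

Definition associated_family (k : nat) (X : 'I_k -> T -> R) : Prop :=
  forall h g : 'rV[R]_k -> R,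
    coordinatewise_nondecreasing h -> coordinatewise_nondecreasing g ->
    let hX := fun w => h (\row_i X i w) in
    let gX := fun w => g (\row_i X i w) in
    covariance_exists hX gX -> (0 <= covariance P hX gX)%E.

Definition associated_sequence (X : nat -> T -> R) : Prop :=
  forall (k : nat) (f : 'I_k -> nat),
    injective f -> associated_family (fun i => X (f i)).

(* Real-valued versions: [fine] sends infinite values to 0, so these are
   meaningful for integrable, resp. square-integrable, variables. *)
Definition Ex (Y : T -> R) : R := fine 'E_P[Y].
Definition Var (Y : T -> R) : R := fine 'V_P[Y].

(* Sequences are indexed from 0: [X i] is the variable X_{i+1}, and
   [psum X n] is S_n = X_1 + ... + X_n. *)
Definition psum (X : nat -> T -> R) (n : nat) : T -> R :=
  fun w => \sum_(i < n) X i w.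

(* S_{jl} - S_{(j-1)l}, used for 1 <= j *)
Definition block (X : nat -> T -> R) (l j : nat) : T -> R :=
  fun w => psum X (j * l)%N w - psum X (j.-1 * l)%N w.

Definition s2 (X : nat -> T -> R) (n : nat) : R := Var (psum X n).
Definition s (X : nat -> T -> R) (n : nat) : R := Num.sqrt (s2 X n).

Definition tau2 (X : nat -> T -> R) (l j : nat) : R := Var (block X l j).
Definition nu2 (X : nat -> T -> R) (l m : nat) : R :=
  \sum_(1 <= j < m.+1) tau2 X l j.
Definition nu (X : nat -> T -> R) (l m : nat) : R := Num.sqrt (nu2 X l m).

(* E(Y^2 1_{|Y| >= c}) *)
Definition tail2 (Y : T -> R) (c : R) : R :=
  Ex (fun w => Y w ^+ 2 * \1_[set u | c <= `|Y u|] w).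

Definition cvg_weakly (Z : nat -> T -> R)
    (mu : probability (measurableTypeR R) R) : Prop :=
  forall f : R -> R, continuous f -> (exists M, forall x, `|f x| <= M) ->
    'E_P[f \o Z n]%E @[n --> \oo] --> (\int[mu]_x (f x)%:E)%E.

End Definitions.

(* Main.v *)
Require Import Defs.
From HB Require Import structures.
From mathcomp Require Import all_boot all_order all_algebra.
From mathcomp Require Import all_classical all_reals all_analysis.
From mathcomp Require Import measurable_realfun complex.
From mathcomp Require Import ring lra.

(** The proof compares the characteristic function of [S_n / s_n] with the
    product of those of the normalized blocks, and then runs the classical
    Lindeberg-Feller argument on that product.

    Dependence.  If [U] and [V] are nondecreasing functions of an associated
    family, and [f], [g] are 1-Lipschitz, then [x + f x] and [x - f x] are
    nondecreasing, and so are [x + g x] and [x - g x]; the positivity of the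
    covariances of these functions of [U] and [V] gives
    [|Cov (f U) (g V)| <= Cov U V] (Cov_lipschitz).  With [f], [g] the sine and
    the cosine, splitting off one summand after the other bounds the distance
    between the characteristic function of a sum and the product of the
    characteristic functions by [2 t^2] times the excess of the variance of the
    sum over the sum of the variances (newman).  All covariances being
    nonnegative, [nu^2 + Var (remainder) <= s_n^2]; since [nu^2 / s_n^2] tends to
    [1], the excess and the remainder are both negligible after normalization.

    From Lindeberg to the normal limit.  The Taylor expansion of order two shows
    that the product of the characteristic functions is close to
    [e^(-t^2/2)] (prod_cf_near_gauss).  Weak convergence follows from a
    continuity theorem (cvg_weakly_of_cf): on [[-K, K]] a bounded continuous
    function is uniformly close to a Bernstein polynomial in [sin (x / K)],
    which is a trigonometric polynomial and is bounded by the same constant on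
    the whole line, while the mass outside is controlled by the second moments
    of the sequence and by the tightness of the limit law.
    The transform of the normal law comes from the equation [y' = - t y].

    From the normal limit to Lindeberg.  With [x_j = 1 - E cos (t Y_j)], small
    individual variances give [|phi_j| >= 1 - x_j >= exp (- x_j / (1 - eta))], so
    the limit [e^(-t^2/2)] of the product forces [sum_j x_j] to be
    asymptotically at least [t^2/2].  But
    [sum_j E (cos (t Y_j) - 1 + t^2 Y_j^2 / 2)], which is [t^2/2] times the sum
    of the variances minus [sum_j x_j], dominates a positive multiple of the
    Lindeberg sum as soon as [t^2/2 > 2/e^2] (lindeberg_of_clt).

    Finally [nu / s_n] tends to [1] and truncated second moments are monotone in
    the truncation level, so both normalizations of that level are equivalent
    (block_lindeberg_nu_s). *)

Import Order.TTheory GRing.Theory Num.Theory.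
Import numFieldNormedType.Exports.
Local Open Scope classical_set_scope.
Local Open Scope ring_scope.

Set Implicit Arguments.
Unset Strict Implicit.
Unset Printing Implicit Defensive.

(** * Elementary inequalities *)

Lemma le_of_derive_ge0 (R : realType) (f df : R -> R) (x : R) :
  (forall y : R, is_derive y (1 : R) f (df y)) -> (forall y, 0 <= y -> 0 <= df y) ->
  0 <= x -> f 0 <= f x.
Proof.
move=> dfE df0 x0.
have [|y /itvP y0 /eqP] := @MVT_segment R f df 0 x x0 (fun y _ => dfE y).
  by apply: derivable_within_continuous => y _.
by rewrite subr0 subr_eq => /eqP ->; rewrite lerDr mulr_ge0 // df0 // y0.
Qed.

Lemma lip1_of_derive (R : realType) (f df : R -> R) (x y : R) :
  (forall y : R, is_derive y (1 : R) f (df y)) -> (forall y, `|df y| <= 1) ->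
  `|f x - f y| <= `|x - y|.
Proof.
move=> dfE df1; wlog yx : x y / y <= x => [hw|].
  have [/hw//|/ltW/hw] := leP y x; by rewrite distrC [X in _ <= X]distrC.
have [|c _ ->] := @MVT_segment R f df y x yx (fun y _ => dfE y).
  by apply: derivable_within_continuous => z _.
by rewrite normrM ler_piMl.
Qed.

Lemma lip1_sin (R : realType) (x y : R) : `|sin x - sin y| <= `|x - y|.
Proof.
by apply: (@lip1_of_derive R sin cos) => z; exact: cos_max.
Qed.

Lemma lip1_cos (R : realType) (x y : R) : `|cos x - cos y| <= `|x - y|.
Proof.
apply: (@lip1_of_derive R cos (fun z => - sin z)) => z.
by rewrite normrN sin_max.
Qed.

Lemma onem_cos_le_sqr (R : realType) (x : R) : 1 - cos x <= x ^+ 2 / 2.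
Proof.
have -> : x = x / 2 *+ 2 by rewrite -mulr_natr; field.
rewrite cos_mulr2n cos2sin2.
have : sin (x / 2) ^+ 2 <= (x / 2) ^+ 2.
  rewrite -[X in X <= _]real_normK ?num_real // -[leRHS]real_normK ?num_real //.
  by rewrite lerXn2r ?nnegrE //; have := lip1_sin (x / 2) 0; rewrite sin0 !subr0.
by move: (sin _) => u; rewrite -mulr_natr; nra.
Qed.

Lemma subr_sin_bounds (R : realType) (x : R) : 0 <= x ->
  0 <= x - sin x /\ (x - sin x <= x ^+ 2 / 2 /\ x - sin x <= x ^+ 3 / 6).
Proof.
move=> x0; split; [|split].
- have := @le_of_derive_ge0 R (fun z => z - sin z) (fun z => 1 - cos z) x.
  rewrite sin0 subrr; apply => // y y0; by rewrite subr_ge0 cos_le1.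
- have := @le_of_derive_ge0 R (fun z => z ^+ 2 / 2 - (z - sin z))
    (fun z => z - (1 - cos z)) x.
  rewrite sin0 subrr expr2 !mul0r subr0 subr_ge0; apply => // y.
  + apply: is_derive_eq; rewrite /GRing.scale/=; lra.
  + move=> y0; rewrite subr_ge0.
    by have := lip1_cos 0 y; rewrite cos0 sub0r normrN (ger0_norm y0); exact/le_trans/ler_norm.
- have := @le_of_derive_ge0 R (fun z => z ^+ 3 / 6 - (z - sin z))
    (fun z => z ^+ 2 / 2 - (1 - cos z)) x.
  rewrite sin0 subrr !exprS !mul0r subr0 subr_ge0; apply => // y.
  + apply: is_derive_eq; rewrite /GRing.scale/= !exprS expr0; lra.
  + by move=> y0; rewrite subr_ge0 onem_cos_le_sqr.
Qed.

Lemma sin_sub_le (R : realType) (x : R) :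
  `|sin x - x| <= x ^+ 2 / 2 /\ `|sin x - x| <= `|x| ^+ 3 / 6.
Proof.
have [x0|x0] := leP 0 x.
  have [h0 [h1 h2]] := subr_sin_bounds x0.
  by rewrite distrC !(ger0_norm h0) (ger0_norm x0).
have Nx0 : 0 <= - x by rewrite oppr_ge0 ltW.
have [h0 [h1 h2]] := subr_sin_bounds Nx0.
rewrite (ltr0_norm x0).
have <- : - x - sin (- x) = sin x - x by rewrite sinN; ring.
by rewrite !(ger0_norm h0) -[x ^+ 2]sqrrN.
Qed.

Lemma cos_taylor2_ge0 (R : realType) (x : R) : 0 <= cos x - 1 + x ^+ 2 / 2.
Proof. by have := onem_cos_le_sqr x; lra. Qed.

Lemma cos_taylor2_le (R : realType) (x : R) :
  cos x - 1 + x ^+ 2 / 2 <= x ^+ 2 / 2 /\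
  cos x - 1 + x ^+ 2 / 2 <= `|x| ^+ 3 / 6.
Proof.
split; first by have := cos_le1 x; lra.
rewrite -cos_norm -[x ^+ 2]real_normK ?num_real //; move: (normr_ge0 x).
move: `|x| => {}x x0.
have := @le_of_derive_ge0 R (fun z => z ^+ 3 / 6 - (cos z - 1 + z ^+ 2 / 2))
    (fun z => z ^+ 2 / 2 - (z - sin z)) x.
rewrite cos0 (_ : 0 ^+ 3 / 6 - (1 - 1 + 0 ^+ 2 / 2) = 0); last by field.
rewrite subr_ge0; apply => // y.
  apply: is_derive_eq; rewrite /GRing.scale/= ?exprS expr0; lra.
by move=> y0; rewrite subr_ge0; have [_ []] := subr_sin_bounds y0.
Qed.

Lemma expRN_taylor1 (R : realType) (y : R) : 0 <= y ->
  0 <= expR (- y) - (1 - y) /\ expR (- y) - (1 - y) <= y ^+ 2.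
Proof.
move=> y0; have h1 := expR_ge1Dx (- y); have h2 := expR_ge1Dx y.
split; first by lra.
have : expR (- y) * (1 + y) <= 1.
  by rewrite expRN mulrC ler_pdivrMr ?expR_gt0 // mul1r.
by move: h1; move: (expR (- y)) => e h1 h3; nra.
Qed.

(** Stated with an upper bound [d] valid for all the factors so that the
    exponents add up when the inequality is multiplied over a family. *)
Lemma expR_le_onem (R : realType) (x d : R) : 0 <= x -> x <= d -> d < 1 ->
  expR (- (x / (1 - d))) <= 1 - x.
Proof.
move=> x0 xd d1.
have d1' : 0 < 1 - d by lra.
have x1 : 0 < 1 - x by lra.
rewrite expRN invf_ple ?posrE ?expR_gt0 //.
apply: le_trans (expR_ge1Dx _).
have -> : (1 - x)^-1 = 1 + x / (1 - x) by field; lra.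
by rewrite lerD2l ler_wpM2l // lef_pV2 ?posrE //; lra.
Qed.

(** * Real-valued expectation and covariance *)

Section Expectation.
Context (d : measure_display) (T : measurableType d) (R : realType).
Variable P : probability T R.
Implicit Types (X Y Z : T -> R) (a M : R).

Notation int := (integrableRV P).
Notation L2 Y := (Y \in Lfun P 2%:E).

Lemma ExE Y : Ex P Y = Rintegral P setT Y.
Proof. by rewrite /Ex unlock. Qed.

Lemma eq_Ex Y Z : Y =1 Z -> Ex P Y = Ex P Z.
Proof. by move=> /funext ->. Qed.

Lemma EFin_Ex Y : int Y -> (Ex P Y)%:E = 'E_P[Y]%E.
Proof. by move=> iY; rewrite /Ex fineK // expectation_fin_num //; apply/Lfun1_integrable. Qed.

Lemma int_le Y Z : measurable_fun setT Y -> int Z ->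
  (forall w, `|Y w| <= Z w) -> int Y.
Proof.
move=> mY iZ YZ; apply: le_integrable iZ => //; first exact/measurable_EFinP.
by move=> w _ /=; rewrite lee_fin (le_trans (YZ w)) ?ler_norm.
Qed.

Lemma int_cst a : int (fun=> a).
Proof. by apply/Lfun1_integrable; exact: Lfun_cst. Qed.

Lemma int_bounded Y M : measurable_fun setT Y -> (forall w, `|Y w| <= M) -> int Y.
Proof. by move=> mY; apply: int_le => //; exact: int_cst. Qed.

Lemma intD Y Z : int Y -> int Z -> int (fun w => Y w + Z w).
Proof.
by move=> /Lfun1_integrable iY /Lfun1_integrable iZ; apply/Lfun1_integrable; exact: rpredD.
Qed.

Lemma intB Y Z : int Y -> int Z -> int (fun w => Y w - Z w).
Proof.
by move=> /Lfun1_integrable iY /Lfun1_integrable iZ; apply/Lfun1_integrable; exact: rpredB.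
Qed.

Lemma intZ a Y : int Y -> int (fun w => a * Y w).
Proof.
move=> /Lfun1_integrable iY; apply/Lfun1_integrable.
have -> : (fun w => a * Y w) = (a \o* Y) by apply/funext => w /=; rewrite mulrC.
exact: Lfun_scale.
Qed.

Lemma int_sum (I : Type) (r : seq I) (F : I -> T -> R) :
  (forall i, int (F i)) -> int (fun w => \sum_(i <- r) F i w).
Proof.
move=> iF; elim: r => [|i r IH].
  by under eq_fun do rewrite big_nil; exact: int_cst.
by under eq_fun do rewrite big_cons; exact: intD.
Qed.

Lemma Ex_cst a : Ex P (fun=> a) = a.
Proof. by rewrite /Ex expectation_cst. Qed.

Lemma ExD Y Z : int Y -> int Z -> Ex P (fun w => Y w + Z w) = Ex P Y + Ex P Z.
Proof. by move=> iY iZ; rewrite !ExE RintegralD. Qed.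

Lemma ExB Y Z : int Y -> int Z -> Ex P (fun w => Y w - Z w) = Ex P Y - Ex P Z.
Proof. by move=> iY iZ; rewrite !ExE RintegralB. Qed.

Lemma ExZ a Y : int Y -> Ex P (fun w => a * Y w) = a * Ex P Y.
Proof. by move=> iY; rewrite !ExE RintegralZl. Qed.

Lemma Ex_sum (I : Type) (r : seq I) (F : I -> T -> R) : (forall i, int (F i)) ->
  Ex P (fun w => \sum_(i <- r) F i w) = \sum_(i <- r) Ex P (F i).
Proof.
move=> iF; elim: r => [|i r IH].
  by under eq_Ex do rewrite big_nil; rewrite big_nil Ex_cst.
under eq_Ex do rewrite big_cons.
by rewrite big_cons ExD ?IH //; exact: int_sum.
Qed.

Lemma le_Ex Y Z : int Y -> int Z -> (forall w, Y w <= Z w) -> Ex P Y <= Ex P Z.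
Proof. by move=> iY iZ YZ; rewrite !ExE le_Rintegral. Qed.

Lemma Ex_ge0 Y : (forall w, 0 <= Y w) -> 0 <= Ex P Y.
Proof. by move=> Y0; rewrite ExE Rintegral_ge0. Qed.

Lemma le_norm_Ex Y Z : int Y -> int Z -> (forall w, `|Y w| <= Z w) ->
  `|Ex P Y| <= Ex P Z.
Proof.
move=> iY iZ YZ; rewrite ler_norml -[- _]mulN1r -ExZ // !le_Ex //; try exact: intZ.
- by move=> w; have := YZ w; rewrite ler_norml => /andP[].
- by move=> w; have := YZ w; rewrite ler_norml mulN1r => /andP[].
Qed.

Lemma L2_measurable Y : L2 Y -> measurable_fun setT Y.
Proof. by move=> /andP[/[!inE]]. Qed.

Lemma L2_sqr Y : L2 Y -> int (fun w => Y w ^+ 2).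
Proof. exact: Lfun2_integrable_sqr. Qed.

Lemma L2_of_sqr Y : measurable_fun setT Y -> int (fun w => Y w ^+ 2) -> L2 Y.
Proof.
move=> mY iY; rewrite inE; apply/andP; split; rewrite inE //=.
rewrite /finite_norm unlock /=.
rewrite poweR_lty // (eq_integral (fun w => `|(Y w ^+ 2)%:E|%E)) => [|w _].
  by case/integrableP: iY.
rewrite /= powR_mulrn // -normrX.
by [].
Qed.

Lemma L2_le Y Z : measurable_fun setT Y -> L2 Z -> (forall w, `|Y w| <= `|Z w|) -> L2 Y.
Proof.
move=> mY /L2_sqr iZ YZ; apply: L2_of_sqr => //.
apply: int_le iZ _ => [|w]; first exact: measurable_funX.
by rewrite normrX -[leRHS]real_normK ?num_real // lerXn2r ?nnegrE.
Qed.

Lemma L2_bounded Y M : measurable_fun setT Y -> (forall w, `|Y w| <= M) -> L2 Y.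
Proof.
move=> mY YM; apply: (@L2_le _ (fun=> M)) => //; first exact: Lfun_cst.
by move=> w; rewrite (le_trans (YM w)) ?ler_norm.
Qed.

Lemma L2_int Y : L2 Y -> int Y.
Proof. by move=> Y2; apply/Lfun1_integrable; apply: Lfun_subset12 Y2; exact: fin_num_measure. Qed.

Lemma L2_mul Y Z : L2 Y -> L2 Z -> int (fun w => Y w * Z w).
Proof. by move=> Y2 Z2; apply/Lfun1_integrable; exact: Lfun2_mul_Lfun1. Qed.

Lemma L2D Y Z : L2 Y -> L2 Z -> L2 (fun w => Y w + Z w).
Proof. by move=> Y2 Z2; apply: rpredD => //; rewrite lee_fin ler1n. Qed.

Lemma L2B Y Z : L2 Y -> L2 Z -> L2 (fun w => Y w - Z w).
Proof. by move=> Y2 Z2; apply: rpredB => //; rewrite lee_fin ler1n. Qed.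

Lemma L2Z a Y : L2 Y -> L2 (fun w => a * Y w).
Proof.
move=> Y2; have -> : (fun w => a * Y w) = (a \o* Y) by apply/funext => w /=; rewrite mulrC.
by apply: Lfun_scale => //; rewrite ler1n.
Qed.

Lemma L2_sum (I : Type) (r : seq I) (F : I -> T -> R) :
  (forall i, L2 (F i)) -> L2 (fun w => \sum_(i <- r) F i w).
Proof.
move=> iF; elim: r => [|i r IH].
  by under eq_fun do rewrite big_nil; exact: Lfun_cst.
by under eq_fun do rewrite big_cons; exact: L2D.
Qed.

Definition Cov Y Z : R := fine (covariance P Y Z).

Lemma VarE_Cov Y : Var P Y = Cov Y Y. Proof. by []. Qed.

Lemma CovE Y Z : L2 Y -> L2 Z ->
  Cov Y Z = Ex P (fun w => Y w * Z w) - Ex P Y * Ex P Z.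
Proof.
move=> Y2 Z2; have iY := L2_int Y2; have iZ := L2_int Z2; have iYZ := L2_mul Y2 Z2.
rewrite /Cov covarianceE; try exact/Lfun1_integrable.
by rewrite -!EFin_Ex.
Qed.

Lemma CovC Y Z : Cov Y Z = Cov Z Y.
Proof. by rewrite /Cov covarianceC. Qed.

Lemma CovDl X Y Z : L2 X -> L2 Y -> L2 Z ->
  Cov (fun w => X w + Y w) Z = Cov X Z + Cov Y Z.
Proof.
move=> X2 Y2 Z2; have iX := L2_int X2; have iY := L2_int Y2.
rewrite !CovE ?L2D // ExD //; under eq_Ex do rewrite mulrDl.
by rewrite ExD; [ring|exact: L2_mul..].
Qed.

Lemma CovDr X Y Z : L2 X -> L2 Y -> L2 Z ->
  Cov Z (fun w => X w + Y w) = Cov Z X + Cov Z Y.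
Proof. by move=> X2 Y2 Z2; rewrite !(CovC Z) CovDl. Qed.

Lemma CovZl a X Z : L2 X -> L2 Z -> Cov (fun w => a * X w) Z = a * Cov X Z.
Proof.
move=> X2 Z2; have iX := L2_int X2.
rewrite !CovE ?L2Z // ExZ //; under eq_Ex do rewrite -mulrA.
by rewrite ExZ; [ring|exact: L2_mul].
Qed.

Lemma CovZr a X Z : L2 X -> L2 Z -> Cov Z (fun w => a * X w) = a * Cov Z X.
Proof. by move=> X2 Z2; rewrite !(CovC Z) CovZl. Qed.

Lemma VarZ a X : L2 X -> Var P (fun w => a * X w) = a ^+ 2 * Var P X.
Proof. by move=> X2; rewrite !VarE_Cov CovZl ?CovZr ?L2Z //; ring. Qed.

Lemma VarD X Y : L2 X -> L2 Y ->
  Var P (fun w => X w + Y w) = Var P X + Var P Y + 2 * Cov X Y.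
Proof.
move=> X2 Y2; rewrite !VarE_Cov CovDl ?L2D // !CovDr // (CovC Y X); ring.
Qed.

Lemma Var_ge0 X : 0 <= Var P X.
Proof. by rewrite /Var fine_ge0 // variance_ge0. Qed.

Lemma Var_mean0 X : L2 X -> Ex P X = 0 -> Var P X = Ex P (fun w => X w ^+ 2).
Proof. by move=> X2 X0; rewrite VarE_Cov CovE // X0 mulr0 subr0; under eq_Ex do rewrite -expr2. Qed.

Lemma measurable_norm_ge Y a : measurable_fun setT Y ->
  measurable [set u | a <= `|Y u|].
Proof.
move=> mY; rewrite -[X in measurable X]setTI.
have -> : [set u | a <= `|Y u|] = (fun u => `|Y u|) @^-1` `[a, +oo[.
  by apply/seteqP; split => u /=; rewrite in_itv /= andbT.
have mN : measurable_fun setT (fun u => `|Y u|) by exact: measurableT_comp.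
exact: mN.
Qed.

Lemma int_tail2 Y a : L2 Y ->
  int (fun w => Y w ^+ 2 * \1_[set u | a <= `|Y u|] w).
Proof.
move=> Y2; have mY := L2_measurable Y2.
apply: int_le (L2_sqr Y2) _ => [|w].
  apply: measurable_funM; first exact: measurable_funX.
  by apply: measurable_indic; exact: measurable_norm_ge.
rewrite normrM normrX real_normK ?num_real // indicE.
by case: (_ \in _); rewrite ?normr1 ?normr0 ?mulr1 ?mulr0 ?sqr_ge0.
Qed.

Lemma tail2_le Y (a b : R) : L2 Y -> a <= b -> tail2 P Y b <= tail2 P Y a.
Proof.
move=> Y2 ab; apply: le_Ex; [exact: int_tail2..|move=> w].
rewrite ler_wpM2l ?sqr_ge0 // !indicE.
have [/set_mem/= bY|_] := boolP (w \in [set u | b <= `|Y u|]); last by [].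
by rewrite mem_set //= (le_trans ab).
Qed.

Lemma tail2_ge0 Y a : 0 <= tail2 P Y a.
Proof. by apply: Ex_ge0 => w; rewrite mulr_ge0 ?sqr_ge0. Qed.

Lemma tail2_le_sqr Y a : L2 Y -> tail2 P Y a <= Ex P (fun w => Y w ^+ 2).
Proof.
move=> Y2; apply: le_Ex; [exact: int_tail2|exact: L2_sqr|move=> w].
by rewrite ler_piMr ?sqr_ge0 // indicE; case: (_ \in _).
Qed.

(** Truncation at level [a]: where [|Y| < a], the square is at most [a^2]. *)
Lemma sqr_le_tail2 Y (a : R) : 0 <= a -> L2 Y ->
  Ex P (fun w => Y w ^+ 2) <= a ^+ 2 + tail2 P Y a.
Proof.
move=> a0 Y2; rewrite -[X in X + _](Ex_cst (a ^+ 2)) -ExD; last exact: int_tail2.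
  apply: le_Ex; [exact: L2_sqr|apply: intD; [exact: int_cst|exact: int_tail2]|move=> w].
  rewrite indicE; have [_|/negP aY] := boolP (w \in [set u | a <= `|Y u|]).
    by rewrite mulr1 lerDr sqr_ge0.
  rewrite mulr0 addr0 -[Y w ^+ 2]real_normK ?num_real // lerXn2r ?nnegrE //.
  by rewrite leNgt; apply/negP => /ltW aYw; apply: aY; rewrite inE.
exact: int_cst.
Qed.

End Expectation.

(** * Characteristic functions of associated variables *)

Section Newman.
Context (d : measure_display) (T : measurableType d) (R : realType).
Variable P : probability T R.
Implicit Types (U V X Y Z : T -> R) (t : R).

Notation L2 Y := (Y \in Lfun P 2%:E).

(** The characteristic function [E (e^(i t Y))]. *)
Definition cf Y t : R[i] :=
  Complex (Ex P (fun w => cos (t * Y w))) (Ex P (fun w => sin (t * Y w))).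

Lemma measurable_cosM t Y : measurable_fun setT Y ->
  measurable_fun setT (fun w => cos (t * Y w)).
Proof.
move=> mY; apply: (measurableT_comp (continuous_measurable_fun (@continuous_cos R))).
exact: measurable_funM.
Qed.

Lemma measurable_sinM t Y : measurable_fun setT Y ->
  measurable_fun setT (fun w => sin (t * Y w)).
Proof.
move=> mY; apply: (measurableT_comp (continuous_measurable_fun (@continuous_sin R))).
exact: measurable_funM.
Qed.

Lemma L2_cos t Y : measurable_fun setT Y -> L2 (fun w => cos (t * Y w)).
Proof. by move=> mY; apply: (@L2_bounded _ _ _ _ _ 1) => [|w]; [exact: measurable_cosM|exact: cos_max]. Qed.

Lemma L2_sin t Y : measurable_fun setT Y -> L2 (fun w => sin (t * Y w)).
Proof. by move=> mY; apply: (@L2_bounded _ _ _ _ _ 1) => [|w]; [exact: measurable_sinM|exact: sin_max]. Qed.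

Lemma normc_le (a b e : R) : `|a| + `|b| <= e -> `|Complex a b| <= e%:C%C.
Proof.
move=> abe; rewrite normc_def lecR; apply: le_trans abe.
rewrite -(@ler_pXn2r _ 2) ?nnegrE ?sqrtr_ge0 ?addr_ge0 // sqr_sqrtr ?addr_ge0 ?sqr_ge0 //.
rewrite sqrrD !real_normK ?num_real //.
have := mulr_ge0 (normr_ge0 a) (normr_ge0 b); rewrite -mulr_natr /=; lra.
Qed.

Lemma norm_cf_le1 Y t : measurable_fun setT Y -> `|cf Y t| <= 1.
Proof.
move=> mY; rewrite /cf normc_def -[1]/(1%:C%C) lecR -sqrtr1 ler_wsqrtr //.
have c2 := L2_cos t mY; have s2 := L2_sin t mY.
have vc := Var_ge0 P (fun w => cos (t * Y w)).
have vs := Var_ge0 P (fun w => sin (t * Y w)).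
rewrite VarE_Cov CovE // in vc; rewrite VarE_Cov CovE // in vs.
suff : Ex P (fun w => cos (t * Y w) * cos (t * Y w)) +
       Ex P (fun w => sin (t * Y w) * sin (t * Y w)) = 1 by rewrite /= !expr2; lra.
rewrite -ExD; try exact: L2_mul.
by under eq_Ex do rewrite -!expr2 cos2Dsin2; rewrite Ex_cst.
Qed.

(** Positive quadrant dependence, phrased with covariances of monotone
    functions; association yields it for any two nondecreasing functions of
    the family, and it passes to the pairs (partial sum, next summand). *)
Definition positively_dependent U V := forall F G : R -> R,
  {homo F : x y / x <= y} -> {homo G : x y / x <= y} ->
  L2 (F \o U) -> L2 (G \o V) -> 0 <= Cov P (F \o U) (G \o V).

Lemma Cov_ge0 U V : positively_dependent U V -> L2 U -> L2 V -> 0 <= Cov P U V.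
Proof. by move=> UV; exact: (UV id id). Qed.

(** A [t]-Lipschitz function [f] is dominated by the slope [t]: both
    [t x + f x] and [t x - f x] are nondecreasing, and expanding the four
    nonnegative covariances of these functions of [U] and [V] bounds
    [Cov (f U) (g V)] on both sides. *)
Lemma Cov_lipschitz (t : R) (f g : R -> R) U V :
  (forall x y, `|f x - f y| <= t * `|x - y|) ->
  (forall x y, `|g x - g y| <= t * `|x - y|) ->
  positively_dependent U V -> L2 U -> L2 V -> L2 (f \o U) -> L2 (g \o V) ->
  `|Cov P (f \o U) (g \o V)| <= t ^+ 2 * Cov P U V.
Proof.
move=> lf lg UV U2 V2 fU2 gV2.
have mono (h : R -> R) (e : R) : `|e| <= 1 -> (forall x y, `|h x - h y| <= t * `|x - y|) ->
    {homo (fun x => t * x + e * h x) : x y / x <= y}.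
  move=> e1 lh x y xy; have := lh y x; rewrite (ger0_norm (_ : 0 <= y - x)) ?subr_ge0 //.
  move=> hxy; have : `|e * (h y - h x)| <= t * (y - x).
    by rewrite normrM (le_trans _ hxy) // ler_piMl.
  by rewrite ler_norml => /andP[]; lra.
have key e e' : `|e| <= 1 -> `|e'| <= 1 ->
    0 <= t ^+ 2 * Cov P U V + t * e' * Cov P U (g \o V)
         + e * t * Cov P (f \o U) V + e * e' * Cov P (f \o U) (g \o V).
  move=> e1 e'1; have := UV _ _ (mono f e e1 lf) (mono g e' e'1 lg).
  move=> /(_ (L2D (L2Z t U2) (L2Z e fU2)) (L2D (L2Z t V2) (L2Z e' gV2))).
  move/le_trans; apply; rewrite le_eqVlt; apply/orP; left; apply/eqP.
  rewrite [LHS](@CovDl _ _ _ P (fun w => t * U w) (fun w => e * (f \o U) w)) ?L2D ?L2Z //.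
  rewrite !(@CovDr _ _ _ P (fun w => t * V w) (fun w => e' * (g \o V) w)) ?L2Z //.
  by rewrite !CovZl ?CovZr ?L2Z //; ring.
have := key 1 1; have := key 1 (- 1); have := key (-1) 1; have := key (-1) (-1).
rewrite !normrN !normr1 => /(_ (lexx _) (lexx _)) k1 /(_ (lexx _) (lexx _)) k2.
move=> /(_ (lexx _) (lexx _)) k3 /(_ (lexx _) (lexx _)) k4.
by rewrite ler_norml; apply/andP; split; lra.
Qed.

Lemma lip_cosM t (x y : R) : `|cos (t * x) - cos (t * y)| <= `|t| * `|x - y|.
Proof. by rewrite -normrM mulrBr lip1_cos. Qed.

Lemma lip_sinM t (x y : R) : `|sin (t * x) - sin (t * y)| <= `|t| * `|x - y|.
Proof. by rewrite -normrM mulrBr lip1_sin. Qed.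

(** By the addition formulas, the real and imaginary parts of the error are a
    difference and a sum of two covariances of trigonometric functions of
    [t U] and [t V]. *)
Lemma cf_add_approx U V t : positively_dependent U V -> L2 U -> L2 V ->
  `|cf (fun w => U w + V w) t - cf U t * cf V t| <= (4 * t ^+ 2 * Cov P U V)%:C%C.
Proof.
move=> UV U2 V2; have mU := L2_measurable U2; have mV := L2_measurable V2.
have cU := L2_cos t mU; have sU := L2_sin t mU.
have cV := L2_cos t mV; have sV := L2_sin t mV.
have := Cov_lipschitz (lip_cosM t) (lip_cosM t) UV U2 V2 cU cV.
have := Cov_lipschitz (lip_sinM t) (lip_sinM t) UV U2 V2 sU sV.
have := Cov_lipschitz (lip_cosM t) (lip_sinM t) UV U2 V2 cU sV.
have := Cov_lipschitz (lip_sinM t) (lip_cosM t) UV U2 V2 sU cV.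
rewrite real_normK ?num_real // /comp.
rewrite !CovE // => h4 h3 h2 h1.
rewrite /cf -[X in `|X|]/(Complex (_ - (_ * _ - _ * _)) (_ - (_ * _ + _ * _))).
apply: normc_le.
under eq_Ex do rewrite mulrDr cosD.
under [X in _ + `|X - _|]eq_Ex do rewrite mulrDr sinD.
rewrite ExB; [|exact: L2_mul..]; rewrite ExD; [|exact: L2_mul..].
set e := t ^+ 2 * _ in h1 h2 h3 h4 *.
have aux (a b c e' : R) : `|a| <= e -> `|b| <= e -> `|c| <= e -> `|e'| <= e ->
    `|a - b| + `|c + e'| <= 4 * e.
  move=> ha hb hc he.
  by have := lerD (ler_normB a b) (ler_normD c e'); lra.
rewrite -mulrA; apply: le_trans (aux _ _ _ _ h1 h2 h3 h4).
rewrite le_eqVlt; apply/orP; left; apply/eqP; congr (_ + _); apply: congr1; ring.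
Qed.

(** Newman's inequality.  Peeling off the last summand costs
    [4 t^2 Cov (D_0 + ... + D_(m-1)) D_m], and twice these covariances add up
    to the excess of the variance of the sum over the sum of the variances. *)
Lemma newman (D : nat -> T -> R) m t :
  (forall j, L2 (D j)) ->
  (forall k, positively_dependent (fun w => \sum_(j < k) D j w) (D k)) ->
  `|cf (fun w => \sum_(j < m) D j w) t - \prod_(j < m) cf (D j) t|
    <= (2 * t ^+ 2 * (Var P (fun w => \sum_(j < m) D j w) - \sum_(j < m) Var P (D j)))%:C%C.
Proof.
move=> D2 pD; have mD j := L2_measurable (D2 j).
elim: m => [|m IH].
  rewrite !big_ord0 /cf; under eq_Ex do rewrite big_ord0 mulr0 cos0.
  under [X in Complex _ X]eq_Ex do rewrite big_ord0 mulr0 sin0.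
  rewrite !Ex_cst subrr normr0 -[0]/(0%:C%C) lecR.
  by rewrite subr0 mulr_ge0 ?Var_ge0 // mulr_ge0 ?sqr_ge0.
have S2 : L2 (fun w => \sum_(j < m) D j w) by exact: L2_sum.
rewrite (_ : (fun w => _) = fun w => \sum_(j < m) D j w + D m w); last first.
  by apply/funext => w; rewrite big_ord_recr.
rewrite !big_ord_recr /= VarD //.
have := cf_add_approx t (pD m) S2 (D2 m).
set z := cf _ t; set x := cf _ t; set y := cf _ t => h.
have -> : z - \prod_(i < m) cf (D i) t * y =
  (z - x * y) + (x - \prod_(i < m) cf (D i) t) * y by rewrite mulrBl; ring.
apply: le_trans (ler_normD _ _) _; rewrite normrM.
have := ler_pM (normr_ge0 _) (normr_ge0 _) IH (norm_cf_le1 t (mD m)).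
move=> /(lerD h)/le_trans; apply.
by rewrite mulr1 -rmorphD lecR; lra.
Qed.

End Newman.

(** * The characteristic function of the standard normal law *)

Section NormalCf.
Context (R : realType).
Notation mu := (@lebesgue_measure R).
Notation phi := (@normal_pdf R 0 1).

(** The density is a Radon-Nikodym derivative of the normal law, hence almost
    everywhere equal to the one in the change of variables formula. *)
Lemma integral_normal_prob (f : R -> R) :
  integrableRV (@normal_prob R 0 1) f ->
  Ex (@normal_prob R 0 1) f = (\int[mu]_x (f x * phi x))%R.
Proof.
move=> fi; rewrite ExE /Rintegral; congr fine.
rewrite -(Radon_Nikodym_change_of_variables (@normal_prob_dominates R 0 1))//=.
have mf : measurable_fun setT (EFin \o f) by exact: measurable_int fi.
under [RHS]eq_integral do rewrite EFinM.
apply: ae_eq_integral => //.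
- apply: emeasurable_funM => //; apply: (measurable_int mu).
  by apply: Radon_Nikodym_integrable; exact: normal_prob_dominates.
- by apply: emeasurable_funM => //; apply/measurable_EFinP; exact: measurable_normal_pdf.
- apply: ae_eqe_mul2l => /=.
  rewrite Radon_NikodymE//=; first exact: normal_prob_dominates.
  move=> nmu; case: cid => /= h [h1 h2 h3].
  apply: integral_ae_eq => //=.
  + by apply/measurable_EFinP; exact: measurable_normal_pdf.
  + by move=> E _ mE; rewrite -h3.
Qed.

Lemma normal_pdfE01 (x : R) : phi x = normal_peak 1 * expR (- x ^+ 2 / 2).
Proof. by rewrite /normal_pdf oner_eq0 /normal_fun subr0 expr1n. Qed.

Lemma derive_normal_pdf (x : R) : is_derive x (1 : R) phi (- x * phi x).
Proof.
have -> : phi = fun x : R => normal_peak 1 * expR (- x ^+ 2 / 2).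
  by apply/funext => y; exact: normal_pdfE01.
apply: is_derive_eq; by rewrite /GRing.scale/= !mulr0 add0r; field.
Qed.

(** [|x| e^(-x^2/2) <= e^(-x^2/4)], an unnormalised normal density. *)
Lemma normal_pdf_dominated : exists c : R, 0 <= c /\
  forall x : R, `|x| * phi x <= c * normal_pdf 0 (Num.sqrt 2) x.
Proof.
have s0 : Num.sqrt 2 != 0 :> R by rewrite gt_eqF // sqrtr_gt0.
have p0 := normal_peak_gt0 s0.
exists (normal_peak 1 / normal_peak (Num.sqrt 2)).
split; first by rewrite divr_ge0 ?normal_peak_ge0.
move=> x; rewrite normal_pdfE01 /normal_pdf (negbTE s0) /normal_fun subr0.
rewrite sqr_sqrtr // mulrCA -mulrA ler_wpM2l ?normal_peak_ge0 //.
rewrite mulKf ?gt_eqF //.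
have -> : - x ^+ 2 / (2 *+ 2) = x ^+ 2 / 4 + - x ^+ 2 / 2 :> R.
  by rewrite -(mulr_natr 2 2); field.
rewrite expRD ler_wpM2r ?expR_ge0 //; apply: le_trans (expR_ge1Dx _).
rewrite -[x ^+ 2]real_normK ?num_real //.
by have := sqr_ge0 (`|x| - 2); rewrite sqrrB -mulr_natr; lra.
Qed.

Lemma integrable_normM_normal_pdf : mu.-integrable setT (fun x => (`|x| * phi x)%:E).
Proof.
have [c [c0 hc]] := normal_pdf_dominated.
have : mu.-integrable setT (fun x => (c%:E * (normal_pdf 0 (Num.sqrt 2) x)%:E)%E).
  by apply: integrableZl => //; exact: integrable_normal_pdf.
apply: le_integrable => //.
  by apply/measurable_EFinP/measurable_funM => //; exact: measurable_normal_pdf.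
move=> x _ /=; rewrite lee_fin ger0_norm; last by rewrite mulr_ge0 // normal_pdf_ge0.
by rewrite (le_trans (hc x)) // ler_norm.
Qed.

Lemma integrable_bounded_normal_pdf (f : R -> R) : measurable_fun setT f ->
  (forall x, `|f x| <= 1) -> mu.-integrable setT (fun x => (f x * phi x)%:E).
Proof.
move=> mf f1; apply: le_integrable (integrable_normal_pdf 0 1) => //.
  by apply/measurable_EFinP/measurable_funM => //; exact: measurable_normal_pdf.
move=> x _ /=; rewrite lee_fin normrM ler_piMl //.
Qed.

Lemma measurable_cos_affine (t th : R) : measurable_fun setT (fun x : R => cos (t * x - th)).
Proof.
apply: (measurableT_comp (continuous_measurable_fun (@continuous_cos R))).
by apply: measurable_funB => //; exact: measurable_funM.
Qed.

Lemma measurable_sin_affine (t th : R) : measurable_fun setT (fun x : R => sin (t * x - th)).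
Proof.
apply: (measurableT_comp (continuous_measurable_fun (@continuous_sin R))).
by apply: measurable_funB => //; exact: measurable_funM.
Qed.

Lemma integrable_xsin_normal_pdf (t th : R) :
  mu.-integrable setT (fun x => (x * sin (t * x - th) * phi x)%:E).
Proof.
apply: le_integrable integrable_normM_normal_pdf => //.
  apply/measurable_EFinP/measurable_funM; last exact: measurable_normal_pdf.
  by apply: measurable_funM => //; exact: measurable_sin_affine.
move=> x _ /=; rewrite lee_fin !normrM normr_id ler_wpM2r // ler_piMr //.
exact: sin_max.
Qed.

(** The derivative of [sin (t x - th) phi x] is integrable with total integral
    [0], since the primitive vanishes at both ends; as [phi' x = - x phi x],
    this is the integration by parts that trades the factor [x] for [t]. *)
Lemma normal_pdf_by_parts (t th : R) :
  (\int[mu]_x (x * sin (t * x - th) * phi x) = t * \int[mu]_x (cos (t * x - th) * phi x))%R.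
Proof.
pose h x := t * (cos (t * x - th) * phi x) - x * sin (t * x - th) * phi x.
pose G x := sin (t * x - th) * phi x.
have ic := integrable_bounded_normal_pdf (measurable_cos_affine t th) (fun x => cos_max _).
have ix := integrable_xsin_normal_pdf t th.
have itc : mu.-integrable setT (EFin \o (fun x => t * (cos (t * x - th) * phi x))).
  have := integrableZl measurableT t ic.
  by apply: eq_integrable => // x _ /=; rewrite EFinM.
have ih : mu.-integrable setT (EFin \o h).
  have := integrableB measurableT itc ix.
  by apply: eq_integrable => // x _ /=; rewrite EFinB.
suff h0 : (\int[mu]_x h x)%R = 0.
  have := h0; rewrite RintegralB // RintegralZl //.
  by move/eqP; rewrite subr_eq0 => /eqP <-.
have dG (x : R) : is_derive x (1 : R) G (h x).
  have dphi := derive_normal_pdf x.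
  apply: is_derive_eq; rewrite /GRing.scale /= /h; ring.
have cphi : continuous phi by apply: continuous_normal_pdf; rewrite oner_eq0.
have caff : continuous (fun x : R => t * x - th).
  by move=> x; apply: cvgB; [apply: cvgM; [exact: cvg_cst|exact: cvg_id]|exact: cvg_cst].
have ch : continuous h.
  move=> x; apply: cvgB.
    apply: cvgM; first exact: cvg_cst.
    apply: cvgM; last exact: cphi.
    by apply: (continuous_comp (caff x)); exact: continuous_cos.
  apply: cvgM; last exact: cphi.
  apply: cvgM; first exact: cvg_id.
  by apply: (continuous_comp (caff x)); exact: continuous_sin.
pose I (n : nat) : set (measurableTypeR R) := `[- n.+1%:R, n.+1%:R]%classic.
have int_n (n : nat) : (\int[mu]_(x in I n) (h x)%:E =
    (G n.+1%:R - G (- n.+1%:R))%R%:E)%E.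
  have cG : continuous G.
    by move=> x; apply/differentiable_continuous/derivable1_diffP; case: (dG x).
  rewrite (@continuous_FTC2 R h G) //.
  - by rewrite (@lt_trans _ _ 0) // oppr_lt0.
  - exact: continuous_subspaceT.
  - split; first by move=> x _; case: (dG x).
      by apply: cvg_at_right_filter; exact: cG.
    by apply: cvg_at_left_filter; exact: cG.
  - by move=> x _; rewrite derive1E; have dGx := dG x; rewrite derive_val.
have G0 : G n.+1%:R - G (- n.+1%:R) @[n --> \oo] --> (0 : R).
  have [c [c0 hc]] := normal_pdf_dominated.
  have s0 : Num.sqrt 2 != 0 :> R by rewrite gt_eqF // sqrtr_gt0.
  pose C := c * normal_peak (Num.sqrt 2).
  have GC (x : R) : `|x| * `|G x| <= C.
    apply: le_trans (_ : `|x| * phi x <= _).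
      rewrite ler_wpM2l // normrM (ger0_norm (normal_pdf_ge0 _ _ _)).
      by rewrite ler_piMl ?normal_pdf_ge0 ?sin_max.
    by apply: le_trans (hc x) _; rewrite ler_wpM2l // normal_pdf_ub.
  apply: norm_cvg0.
  have lim0 : (2 * C) * n.+1%:R^-1 @[n --> \oo] --> (0 : R).
    by rewrite -[0](mulr0 (2 * C)); apply: cvgM; [exact: cvg_cst|exact: cvg_harmonic].
  apply: (@squeeze_cvgr _ _ _ _ (cst 0) _ _ _ _ _ lim0) => //; last exact: cvg_cst.
  apply: nearW => n; rewrite normr_ge0 /= ler_pdivlMr // mulrC.
  have := GC n.+1%:R; have := GC (- n.+1%:R); rewrite normrN ger0_norm // => h1 h2.
  apply: le_trans (_ : n.+1%:R * (`|G n.+1%:R| + `|G (- n.+1%:R)|) <= _).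
    by rewrite ler_wpM2l // ler_normB.
  by rewrite mulrDr; lra.
have mI n : measurable (I n) by exact: measurable_itv.
have mh := measurable_int _ ih.
have mf n : measurable_fun [set: measurableTypeR R] ((EFin \o h) \_ (I n)).
  by apply/(measurable_restrictT _ (mI n)); exact: measurable_funTS mh.
have lim_f (x : measurableTypeR R) : ((EFin \o h) \_ (I n)) x @[n --> \oo] --> (EFin \o h) x.
  apply: cvg_near_cst; near=> n; rewrite patchE mem_set // /I /= in_itv /= -ler_norml.
  apply: (@le_trans _ _ n%:R); last by rewrite ler_nat.
  by near: n; exact: nbhs_infty_ger.
have dom_f (x : measurableTypeR R) (n : nat) : [set: measurableTypeR R] x ->
    (`|((EFin \o h) \_ (I n)) x| <= `|(EFin \o h) x|)%E.
  by move=> _; rewrite patchE; case: ifP => // _; rewrite abse0.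
have [_ _ limI] := @dominated_convergence _ _ _ mu setT measurableT _ _ _ mf mh
  (aeW mu (fun x _ => lim_f x)) (integrable_abse ih) (aeW mu dom_f).
have lim0 : (\int[mu]_x ((EFin \o h) \_ (I n)) x)%E @[n --> \oo] --> 0%E.
  rewrite (_ : (fun n => _) = fun n => (G n.+1%:R - G (- n.+1%:R))%R%:E).
    by apply/fine_cvgP; split; [exact: nearW|exact: G0].
  by apply/funext => n; rewrite -int_n -integral_mkcond.
by rewrite /Rintegral; have -> := cvg_unique _ limI lim0.
Unshelve. all: by end_near. Qed.

(** The phase [th] treats the cosine ([th = 0]) and the sine ([th = pi / 2])
    at the same time. *)
Definition normal_cos (th t : R) : R := (\int[mu]_x (cos (t * x - th) * phi x))%R.

(** Differentiation under the integral sign, the derivative of the integrand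
    being dominated by [|x| phi x]. *)
Lemma is_derive_normal_cos (th t : R) :
  is_derive t (1 : R) (normal_cos th) (- t * normal_cos th t).
Proof.
pose f (s x : R) := cos (s * x - th) * phi x.
have Dx (s x : R) : is_derive s (1 : R) (f^~ x) (- (x * sin (s * x - th) * phi x)).
  apply: is_derive_eq; rewrite /GRing.scale /=; ring.
have intf (s : R) : `]t - 1, t + 1[%classic s -> mu.-integrable setT (EFin \o f s).
  by move=> _; exact: integrable_bounded_normal_pdf (measurable_cos_affine s th) (fun x => cos_max _).
have ta : `]t - 1, t + 1[%classic t by rewrite /= in_itv /=; lra.
have df (s x : R) : `]t - 1, t + 1[%classic s -> setT x -> derivable (f^~ x) s 1.
  by move=> _ _; case: (Dx s x).
have dE (s x : R) : partial1of2 f s x = - (x * sin (s * x - th) * phi x).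
  by rewrite partial1of2E; have := Dx s x => ?; rewrite derive_val.
have dub (s x : R) : `]t - 1, t + 1[%classic s -> setT x ->
    `|partial1of2 f s x| <= `|x| * phi x.
  move=> _ _; rewrite dE normrN !normrM (ger0_norm (normal_pdf_ge0 _ _ _)).
  by rewrite ler_wpM2r ?normal_pdf_ge0 // ler_piMr // sin_max.
have g0 (x : R) : 0 <= `|x| * phi x by rewrite mulr_ge0 // normal_pdf_ge0.
have ig := integrable_normM_normal_pdf.
apply: DeriveDef.
  exact: (derivable_under_integral measurableT ta intf df g0 ig dub).
rewrite -derive1E (differentiation_under_integral measurableT ta intf df g0 ig dub).
rewrite mulNr -normal_pdf_by_parts -mulN1r -RintegralZl //; last first.
  exact: integrable_xsin_normal_pdf.
by apply: eq_Rintegral => x _; rewrite dE mulN1r.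
Qed.

(** The derivative of [normal_cos th u * e^(u^2/2)] vanishes by the equation
    [y' = - u y]. *)
Lemma normal_cosE (th t : R) : normal_cos th t = cos th * expR (- t ^+ 2 / 2).
Proof.
pose H (u : R) := normal_cos th u * expR (u ^+ 2 / 2).
have H' (u : R) : is_derive u (1 : R) H 0.
  have dn := is_derive_normal_cos th u.
  by apply: is_derive_eq; rewrite /GRing.scale /= !mulr0 add0r; field.
have := is_derive_0_is_cst t 0 H'.
rewrite /H expr0n /= mul0r expR0 mulr1.
have -> : normal_cos th 0 = cos th.
  rewrite /normal_cos; under eq_Rintegral do rewrite mul0r sub0r cosN.
  rewrite RintegralZl //; last exact: integrable_normal_pdf.
  by rewrite /Rintegral integral_normal_pdf mulr1.
move=> <-; rewrite -mulrA -expRD.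
by rewrite (_ : _ + _ = 0) ?expR0 ?mulr1 //; ring.
Qed.

Lemma normal_Ecos (t : R) :
  Ex (@normal_prob R 0 1) (fun x => cos (t * x)) = expR (- t ^+ 2 / 2).
Proof.
rewrite integral_normal_prob.
  transitivity (normal_cos 0 t); last by rewrite normal_cosE cos0 mul1r.
  by apply: eq_Rintegral => x _; rewrite subr0.
by apply: L2_int; apply: L2_cos; exact: measurable_id.
Qed.

Lemma normal_Esin (t : R) :
  Ex (@normal_prob R 0 1) (fun x => sin (t * x)) = 0.
Proof.
rewrite integral_normal_prob.
  transitivity (normal_cos (pi / 2) t); last by rewrite normal_cosE cos_pihalf mul0r.
  by apply: eq_Rintegral => x _; rewrite cosBpihalf.
by apply: L2_int; apply: L2_sin; exact: measurable_id.
Qed.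

End NormalCf.

(** * Trigonometric approximation and the continuity theorem *)

Section Approximation.
Context (R : realType).

(** Compactness of the interval, in its near-covering form, applied to the
    radii [1 / (n + 1)].  Only [x] is confined to the interval. *)
Lemma uniformly_continuous_itv (f : R -> R) (a b e : R) : continuous f -> 0 < e ->
  exists2 dl : R, 0 < dl & forall x y, a <= x <= b -> `|x - y| < dl -> `|f x - f y| < e.
Proof.
move=> cf e0.
pose Q (n : nat) (x : R) := forall y, `|x - y| < n.+1%:R^-1 -> `|f x - f y| < e.
have := (@compact_near_coveringP R `[a, b]%classic).1 (@segment_compact R a b).
move=> /(_ nat \oo Q) [].
- move=> x _; have /cvgrPdist_lt/(_ (e / 2)) := cf x.
  have e20 : 0 < e / 2 by rewrite divr_gt0.
  move=> /(_ e20) /nbhs_ballP [r /= r0 xr].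
  exists (ball x (r / 2), [set n | n.+1%:R^-1 < r / 2]) => /=.
    split; first by apply: nbhsx_ballx; rewrite divr_gt0.
    have r20 : 0 < r / 2 by rewrite divr_gt0.
    have := @cvg_harmonic R; move/cvgrPdist_lt => /(_ _ r20).
    apply: filterS => n /=; rewrite sub0r normrN ger0_norm //.
  case=> x' n [/= xx' nr] y x'y.
  have h1 : `|f x - f x'| < e / 2.
    by apply: xr => /=; apply: lt_trans xx' _; rewrite ltr_pdivrMr // mulr_natr mulr2n ltrDl.
  have h2 : `|f x - f y| < e / 2.
    have xyr : `|x - y| < r.
      apply: le_lt_trans (ler_distD x' _ _) _.
      by rewrite [ltRHS]splitr ltrD // (lt_trans x'y).
    exact: xr xyr.
  apply: le_lt_trans (ler_distD (f x) _ _) _.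
  by rewrite [ltRHS]splitr ltrD // distrC.
- move=> N _ /(_ N (leqnn N)) hN; exists N.+1%:R^-1; first by rewrite invr_gt0.
  by move=> x y xab; apply: hN; rewrite /= in_itv.
Qed.

(** [walk N g y n u] is the expectation of [g] at the position, after [n]
    steps, of a walk that starts at [u] and moves by [1/N] with probability
    [y]; the [N]-th Bernstein polynomial of [g] is [walk N g y N 0]. *)
Fixpoint walk (N : R) (g : R -> R) (y : R) (n : nat) (u : R) : R :=
  if n is n'.+1 then y * walk N g y n' (u + N^-1) + (1 - y) * walk N g y n' u
  else g u.

(** The square of the distance to [y] has expectation squared drift plus
    variance, which is why a quadratic bound on [g] propagates. *)
Lemma walk_dist (N : R) (g : R -> R) (y c e C : R) n u : 0 <= y <= 1 -> N != 0 -> 0 <= C ->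
  (forall u, `|g u - c| <= e + C * (u - y) ^+ 2) ->
  `|walk N g y n u - c| <=
    e + C * ((u + n%:R * y / N - y) ^+ 2 + n%:R * (y * (1 - y)) / N ^+ 2).
Proof.
move=> /andP[y0 y1] N0 C0 hg; elim: n u => [|n IH] u /=.
  by rewrite !mul0r !addr0.
have -> : y * walk N g y n (u + N^-1) + (1 - y) * walk N g y n u - c =
    y * (walk N g y n (u + N^-1) - c) + (1 - y) * (walk N g y n u - c) by ring.
apply: le_trans (ler_normD _ _) _; rewrite !normrM (ger0_norm y0).
rewrite (ger0_norm (_ : 0 <= 1 - y)) ?subr_ge0 //.
have y1' : 0 <= 1 - y by rewrite subr_ge0.
have := lerD (ler_wpM2l y0 (IH (u + N^-1))) (ler_wpM2l y1' (IH u)).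
move/le_trans; apply; rewrite le_eqVlt; apply/orP; left; apply/eqP.
by rewrite -[in RHS]natr1; field.
Qed.

Lemma walk_bound (N : R) (g : R -> R) (y M : R) n u : 0 <= y <= 1 ->
  (forall u, `|g u| <= M) -> `|walk N g y n u| <= M.
Proof.
move=> /andP[y0 y1] gM; elim: n u => [|n IH] u //=.
apply: le_trans (ler_normD _ _) _; rewrite !normrM (ger0_norm y0).
rewrite (ger0_norm (_ : 0 <= 1 - y)) ?subr_ge0 //.
have y1' : 0 <= 1 - y by rewrite subr_ge0.
have := lerD (ler_wpM2l y0 (IH (u + N^-1))) (ler_wpM2l y1' (IH u)).
by move/le_trans; apply; rewrite -mulrDl addrC subrK mul1r.
Qed.

(** Chebyshev's argument: [|g u - g y|] is at most [e / 2] near [y] and at most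
    [C (u - y)^2] away from it, and after [N] steps of length [1/N] the walk has
    mean [y] and variance [y (1 - y) / N]. *)
Lemma bernstein_approx (g : R -> R) (M e : R) : continuous g ->
  (forall u, `|g u| <= M) -> 0 < e ->
  exists N : nat, forall y, 0 <= y <= 1 -> `|walk N.+1%:R g y N.+1 0 - g y| <= e.
Proof.
move=> cg gM e0.
have M0 : 0 <= M by apply: le_trans (gM 0).
have e20 : 0 < e / 2 by rewrite divr_gt0.
have [dl dl0 hdl] := uniformly_continuous_itv 0 1 cg e20.
pose C := 2 * M / dl ^+ 2.
have C0 : 0 <= C by apply: divr_ge0; [exact: mulr_ge0|exact: sqr_ge0].
have quad y u : 0 <= y <= 1 -> `|g u - g y| <= e / 2 + C * (u - y) ^+ 2.
  move=> y01; have [uy|uy] := ltP `|y - u| dl.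
    by rewrite distrC (le_trans (ltW (hdl _ _ y01 uy))) // lerDl mulr_ge0 ?sqr_ge0.
  apply: le_trans (_ : 2 * M <= _).
    by apply: le_trans (ler_normB _ _) _; have := gM u; have := gM y; lra.
  rewrite -[2 * M]add0r lerD ?(ltW e20) // /C mulrAC ler_pdivlMr ?exprn_gt0 //.
  rewrite ler_wpM2l ?mulr_ge0 // -[(u - y) ^+ 2]real_normK ?num_real // distrC.
  by rewrite lerXn2r ?nnegrE // ltW.
pose N := Num.truncn (C / (e / 2)).
exists N => y y01.
have N0 : (N.+1%:R : R) != 0 by rewrite pnatr_eq0.
apply: le_trans (walk_dist N.+1 0 y01 N0 C0 (fun u => quad y u y01)) _.
have -> : 0 + N.+1%:R * y / N.+1%:R - y = 0 by field.
have -> : N.+1%:R * (y * (1 - y)) / N.+1%:R ^+ 2 = y * (1 - y) / N.+1%:R by field.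
rewrite expr0n /= add0r [leRHS]splitr lerD2l.
have CN : C <= e / 2 * N.+1%:R.
  rewrite mulrC -ler_pdivrMr // ltW // /N.
  by have := truncnS_gt (C / (e / 2)).
rewrite mulrA ler_pdivrMr ?ltr0n //; apply: le_trans CN.
case/andP: y01 => y0 y1; rewrite -[leRHS]mulr1 ler_wpM2l //.
by nra.
Qed.

Inductive trigpoly : (R -> R) -> Prop :=
| trigpoly_cos t : trigpoly (fun x => cos (t * x))
| trigpoly_sin t : trigpoly (fun x => sin (t * x))
| trigpoly_lin a b f g : trigpoly f -> trigpoly g -> trigpoly (fun x => a * f x + b * g x).

Lemma trigpoly_cst c : trigpoly (fun=> c).
Proof.
have -> : (fun=> c) = fun x : R => c * cos (0 * x) + 0 * cos (0 * x).
  by apply/funext => x; rewrite !mul0r cos0 mulr1 addr0.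
by apply: trigpoly_lin; exact: trigpoly_cos.
Qed.

(** Product-to-sum formulas. *)
Lemma trigpoly_mul_sin s f : trigpoly f -> trigpoly (fun x => sin (s * x) * f x).
Proof.
elim=> [t|t|a b {}f g _ IHf _ IHg].
- have -> : (fun x => sin (s * x) * cos (t * x)) =
      fun x : R => 2^-1 * sin ((s + t) * x) + 2^-1 * sin ((s - t) * x).
    by apply/funext => x; rewrite mulrDl mulrBl sinD sinB; field.
  by apply: trigpoly_lin; exact: trigpoly_sin.
- have -> : (fun x => sin (s * x) * sin (t * x)) =
      fun x : R => 2^-1 * cos ((s - t) * x) + (- 2^-1) * cos ((s + t) * x).
    by apply/funext => x; rewrite mulrBl mulrDl cosB cosD; field.
  by apply: trigpoly_lin; exact: trigpoly_cos.
- have -> : (fun x => sin (s * x) * (a * f x + b * g x)) =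
      fun x : R => a * (sin (s * x) * f x) + b * (sin (s * x) * g x).
    by apply/funext => x; ring.
  exact: trigpoly_lin.
Qed.

Lemma trigpoly_walk (N : R) (g : R -> R) (s : R) n u :
  trigpoly (fun x => walk N g ((1 + sin (s * x)) / 2) n u).
Proof.
elim: n u => [|n IH] u /=; first exact: trigpoly_cst.
pose a x := walk N g ((1 + sin (s * x)) / 2) n (u + N^-1).
pose b x := walk N g ((1 + sin (s * x)) / 2) n u.
have ab : trigpoly (fun x => 2^-1 * a x + 2^-1 * b x).
  by apply: trigpoly_lin; exact: IH.
have sab : trigpoly (fun x => 2^-1 * (sin (s * x) * a x) + (- 2^-1) * (sin (s * x) * b x)).
  by apply: trigpoly_lin; apply: trigpoly_mul_sin; exact: IH.
have := trigpoly_lin 1 1 ab sab; congr trigpoly.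
by apply/funext => x; rewrite /a /b; field.
Qed.

Lemma trigpoly_continuous f : trigpoly f -> continuous f.
Proof.
have clin t : continuous (fun x : R => t * x).
  by move=> x; apply: cvgM; [exact: cvg_cst|exact: cvg_id].
elim=> [t|t|a b {}f g _ IHf _ IHg] x.
- by apply: (continuous_comp (clin t x)); exact: continuous_cos.
- by apply: (continuous_comp (clin t x)); exact: continuous_sin.
- by apply: cvgD; apply: cvgM; [exact: cvg_cst|exact: IHf|exact: cvg_cst|exact: IHg].
Qed.

(** The projection onto [[-a, a]]. *)
Definition clamp (a y : R) := (`|y + a| - `|y - a|) / 2.

Lemma clamp_itv (a y : R) : 0 <= a -> - a <= clamp a y <= a.
Proof.
move=> a0; rewrite /clamp.
by case: (ger0P (y + a)) => ?; case: (ger0P (y - a)) => ?; lra.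
Qed.

Lemma clamp_id (a y : R) : - a <= y <= a -> clamp a y = y.
Proof.
move=> ya; rewrite /clamp (@ger0_norm _ (y + a)) ?(@ler0_norm _ (y - a)); lra.
Qed.

Lemma continuous_clamp (a : R) : continuous (clamp a).
Proof.
move=> y; apply: cvgM; last exact: cvg_cst.
apply: cvgB; apply: cvg_norm; first by apply: cvgD; [exact: cvg_id|exact: cvg_cst].
by apply: cvgB; [exact: cvg_id|exact: cvg_cst].
Qed.

(** The map [x |-> sin (x / K)] is injective on [[-K, K]], so there [f x] is a
    continuous function of [sin (x / K)], and a Bernstein polynomial in the
    latter is a trigonometric polynomial in [x], bounded on the whole line. *)
Lemma trigpoly_approx (f : R -> R) (M K e : R) : continuous f ->
  (forall x, `|f x| <= M) -> 0 < K -> 0 < e ->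
  exists2 p, trigpoly p & (forall x, `|p x| <= M) /\
    (forall x, `|x| <= K -> `|f x - p x| <= e).
Proof.
move=> cf fM K0 e0.
have s0 : 0 < sin (1 : R) by apply: sin2_gt0; rewrite ltr01 ltr1n.
have s1 : sin (1 : R) < 1.
  rewrite ltNge; apply/negP => s1; have := cos2Dsin2 (1 : R).
  have := exprn_gt0 2 (@cos1_gt0 R); have := exprn_ege1 2 s1; lra.
have clamp1 y : -1 < clamp (sin 1) y < 1.
  by have := clamp_itv y (ltW s0); lra.
pose g (y : R) := f (K * asin (clamp (sin 1) (2 * y - 1))).
have cg : continuous g.
  have c1 : continuous (fun y : R => 2 * y - 1).
    by move=> z; apply: cvgB; [apply: cvgM; [exact: cvg_cst|exact: cvg_id]|exact: cvg_cst].
  have c2 : continuous (fun y : R => clamp (sin 1) (2 * y - 1)).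
    by move=> z; apply: (continuous_comp (c1 z)); exact: continuous_clamp.
  have c3 : continuous (fun y : R => asin (clamp (sin 1) (2 * y - 1))).
    by move=> z; apply: (continuous_comp (c2 z)); exact: continuous_asin.
  have c4 : continuous (fun y : R => K * asin (clamp (sin 1) (2 * y - 1))).
    by move=> z; apply: cvgM; [exact: cvg_cst|exact: c3].
  by move=> z; apply: (continuous_comp (c4 z)); exact: cf.
have [N hN] := bernstein_approx cg (fun u => fM _) e0.
pose y x : R := (1 + sin (K^-1 * x)) / 2.
have y01 x : 0 <= y x <= 1.
  by have := sin_le1 (K^-1 * x); have := sin_geN1 (K^-1 * x); rewrite /y; lra.
exists (fun x => walk N.+1%:R g (y x) N.+1 0); first exact: trigpoly_walk.
split=> x; first by apply: walk_bound => // u; exact: fM.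
move=> xK; suff -> : f x = g (y x) by rewrite distrC hN.
have : -1 <= K^-1 * x <= 1.
  rewrite -ler_norml normrM gtr0_norm ?invr_gt0 //.
  by rewrite mulrC ler_pdivrMr // mul1r.
rewrite /g /y; set v := K^-1 * x => /andP[v1 v2].
have -> : 2 * ((1 + sin v) / 2) - 1 = sin v by field.
have pi1 := pihalf_ge1 R.
have in1 (z : R) : -1 <= z <= 1 -> z \in `[(- (pi / 2)), pi / 2].
  by rewrite in_itv /= => /andP[? ?]; apply/andP; split; lra.
have lesin (z w : R) : -1 <= z <= 1 -> -1 <= w <= 1 -> z <= w -> sin z <= sin w.
  by move=> z1 w1 zw; rewrite leNgt ltr_sin ?in1 // -leNgt.
have sv1 : sin v <= sin 1 by apply: lesin => //; rewrite ?v1 ?v2 //; lra.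
have sv2 : - sin 1 <= sin v by rewrite -sinN; apply: lesin => //; rewrite ?v1 ?v2 //; lra.
rewrite clamp_id ?sv1 ?sv2 //.
rewrite sinK ?in1 ?v1 ?v2 // /v mulrA divff ?mul1r //.
by rewrite gt_eqF.
Qed.

End Approximation.

Section Continuity.
Context (d : measure_display) (T : measurableType d) (R : realType).
Variables (P : probability T R) (mu : probability (measurableTypeR R) R).
Variable Z : nat -> T -> R.
Hypothesis mZ : forall n, measurable_fun setT (Z n).
Hypothesis cvg_cos : forall t : R,
  Ex P (fun w => cos (t * Z n w)) @[n --> \oo] --> Ex mu (fun x => cos (t * x)).
Hypothesis cvg_sin : forall t : R,
  Ex P (fun w => sin (t * Z n w)) @[n --> \oo] --> Ex mu (fun x => sin (t * x)).

Lemma int_comp_bounded (dS : measure_display) (S : measurableType dS) (Q : probability S R)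
    (f : R -> R) (Y : S -> R) M : continuous f -> (forall x, `|f x| <= M) ->
  measurable_fun setT Y -> integrableRV Q (fun w => f (Y w)).
Proof.
move=> cf fM mY; apply: (@int_bounded _ _ _ _ _ M) => // .
by apply: (measurableT_comp (continuous_measurable_fun cf)).
Qed.

Lemma trigpoly_bounded (f : R -> R) : trigpoly f -> exists M, forall x, `|f x| <= M.
Proof.
elim=> [t|t|a b {}f g _ [M fM] _ [N gN]].
- by exists 1 => x; exact: cos_max.
- by exists 1 => x; exact: sin_max.
- exists (`|a| * M + `|b| * N) => x; apply: le_trans (ler_normD _ _) _.
  by rewrite !normrM lerD // ler_wpM2l.
Qed.

Lemma cvg_trigpoly (p : R -> R) : trigpoly p ->
  Ex P (fun w => p (Z n w)) @[n --> \oo] --> Ex mu p.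
Proof.
elim=> [t|t|a b f g tf IHf tg IHg]; [exact: cvg_cos|exact: cvg_sin|].
have [M fM] := trigpoly_bounded tf; have [N gN] := trigpoly_bounded tg.
have cf := trigpoly_continuous tf; have cg := trigpoly_continuous tg.
have ifn n := int_comp_bounded P cf fM (mZ n).
have ign n := int_comp_bounded P cg gN (mZ n).
have ifm : integrableRV mu f := int_comp_bounded mu cf fM (@measurable_id _ _ setT).
have igm : integrableRV mu g := int_comp_bounded mu cg gN (@measurable_id _ _ setT).
rewrite (ExD (intZ a ifm) (intZ b igm)) (ExZ a ifm) (ExZ b igm).
under eq_fun => n do rewrite (ExD (intZ a (ifn n)) (intZ b (ign n))) (ExZ a (ifn n)) (ExZ b (ign n)).
by apply: cvgD; apply: cvgM => //; exact: cvg_cst.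
Qed.

Lemma measurable_norm_gt (K : R) : measurable [set x : measurableTypeR R | K < `|x|].
Proof.
have -> : [set x : measurableTypeR R | K < `|x|] = ~` `[- K, K]%classic.
  by apply/seteqP; split => x /=; rewrite in_itv /= -ler_norml ltNge => /negP.
by apply: measurableC; exact: measurable_itv.
Qed.

(** The sets [{|x| > K}] decrease to the empty set. *)
Lemma tight_mu (e : R) : 0 < e ->
  exists2 K0 : R, 0 < K0 & forall K, K0 <= K -> Ex mu \1_[set x | K < `|x|] <= e.
Proof.
move=> e0; pose A n := [set x : measurableTypeR R | n.+1%:R < `|x|].
have mA n : measurable (A n) := measurable_norm_gt _.
have A0 : \bigcap_n A n = set0.
  apply/seteqP; split => x //= /(_ (Num.truncn `|x|) I) /=.
  by rewrite /A /= ltNge (ltW (truncnS_gt _)).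
have := @nonincreasing_cvg_mu _ _ _ mu A.
rewrite A0 measure0 => cA.
have /fine_cvgP[_ /cvgrPdist_le/(_ _ e0)[N _ hN]] : mu (A n) @[n --> \oo] --> 0%E.
  apply: cA => //.
  - by rewrite (le_lt_trans (probability_le1 _ (mA _))) ?ltry.
  - move=> m n mn; apply/subsetPset => x /=; apply: le_lt_trans.
    by rewrite ler_nat ltnS.
exists N.+1%:R => // K NK.
have := hN N (leqnn N); rewrite /= sub0r normrN => /(le_trans (ler_norm _)).
apply: le_trans; rewrite -[X in _ <= fine X]expectation_indic // -/(Ex mu _).
have im (L : R) : integrableRV mu \1_[set x | L < `|x|].
  apply: (@int_bounded _ _ _ _ _ 1) => [|x].
    by apply: measurable_indic; exact: measurable_norm_gt.
  by rewrite indicE; case: (_ \in _); rewrite ?normr1 ?normr0.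
apply: le_Ex; [exact: im|exact: im|move=> x; rewrite !indicE].
have [/set_mem/= Kx|_] := boolP (x \in [set x | K < `|x|]); last by [].
by rewrite mem_set // /A /= (le_lt_trans NK).
Qed.

(** Continuity theorem, with tightness of the sequence given by a bound on its
    second moments: outside [[-K, K]] the error [2 M] of the trigonometric
    approximation is at most [2 M (x / K)^2]. *)
Lemma cvg_weakly_of_cf (C : R) :
  (forall n, Z n \in Lfun P 2%:E) ->
  (\forall n \near \oo, Ex P (fun w => Z n w ^+ 2) <= C) ->
  cvg_weakly P Z mu.
Proof.
move=> Z2 ZC f cf [M fM].
have M0 : 0 <= M by apply: le_trans (fM 0).
have ifn n := int_comp_bounded P cf fM (mZ n).
have ifm : integrableRV mu f := int_comp_bounded mu cf fM (@measurable_id _ _ setT).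
have -> : (\int[mu]_x (f x)%:E)%E = (Ex mu f)%:E by rewrite (EFin_Ex ifm) unlock.
rewrite (_ : (fun n => _) = fun n => (Ex P (fun w => f (Z n w)))%:E); last first.
  by apply/funext => n; rewrite (EFin_Ex (ifn n)).
apply/fine_cvgP; split; first exact: nearW.
apply/cvgrPdist_le => e e0 /=.
(* the three errors below add up to (3 + 4 M) a *)
pose a := e / (3 + 4 * M).
have a0 : 0 < a by rewrite divr_gt0 //; lra.
have [K0 K00 hK0] := tight_mu a0.
(* large enough for the tail of mu and for C / K^2 <= a *)
pose K := K0 + Num.sqrt (`|C| / a).
have K0K : K0 <= K by rewrite lerDl sqrtr_ge0.
have Kgt0 : 0 < K by apply: lt_le_trans K0K.
have CK : C / K ^+ 2 <= a.
  rewrite ler_pdivrMr ?exprn_gt0 //; apply: le_trans (ler_norm _) _.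
  rewrite mulrC -ler_pdivrMr // -(@sqr_sqrtr _ (`|C| / a)); last first.
    by apply: divr_ge0 => //; exact: ltW.
  by rewrite lerXn2r ?nnegrE ?sqrtr_ge0 ?(ltW Kgt0) // lerDr ltW.
have [p tp [pM fp]] := trigpoly_approx cf fM Kgt0 a0.
have cp := trigpoly_continuous tp.
have ipn n := int_comp_bounded P cp pM (mZ n).
have ipm : integrableRV mu p := int_comp_bounded mu cp pM (@measurable_id _ _ setT).
have fp2 x : `|f x - p x| <= 2 * M.
  by apply: le_trans (ler_normB _ _) _; have := fM x; have := pM x; lra.
have step1 : `|Ex mu f - Ex mu p| <= a + 2 * M * a.
  have i1 : integrableRV mu \1_[set x | K < `|x|].
    apply: (@int_bounded _ _ _ _ _ 1) => [|x].
      by apply: measurable_indic; exact: measurable_norm_gt.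
    by rewrite indicE; case: (_ \in _); rewrite ?normr1 ?normr0.
  rewrite -ExB //; apply: le_trans (le_norm_Ex (intB ifm ipm)
    (intD (int_cst mu a) (intZ (2 * M) i1)) _) _.
    move=> x; rewrite indicE.
    have [_|/negP Kx] := boolP (x \in [set x | K < `|x|]).
      by rewrite mulr1 (le_trans (fp2 x)) // lerDr ltW.
    rewrite mulr0 addr0 fp // leNgt; apply/negP => Kx'; apply: Kx.
    by rewrite inE.
  by rewrite (ExD (int_cst mu a) (intZ _ i1)) (ExZ _ i1) Ex_cst lerD2l ler_wpM2l ?hK0 ?mulr_ge0.
near=> n.
have step3 : `|Ex P (fun w => p (Z n w)) - Ex P (fun w => f (Z n w))| <= a + 2 * M * a.
  have i1 := L2_sqr (Z2 n).
  rewrite -ExB //; apply: le_trans (le_norm_Ex (intB (ipn n) (ifn n))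
    (intD (int_cst P a) (intZ (2 * M / K ^+ 2) i1)) _) _.
    move=> w; rewrite distrC; set x := Z n w.
    have [xK|Kx] := leP `|x| K.
      rewrite (le_trans (fp x xK)) // lerDl.
      by rewrite mulr_ge0 ?sqr_ge0 // divr_ge0 ?sqr_ge0 // mulr_ge0.
    apply: le_trans (fp2 x) _; rewrite -[leLHS]add0r lerD ?(ltW a0) //.
    rewrite (mulrAC (2 * M)) ler_pdivlMr ?exprn_gt0 // ler_wpM2l ?mulr_ge0 //.
    by rewrite -[x ^+ 2]real_normK ?num_real // lerXn2r ?nnegrE ?(ltW Kgt0) ?(ltW Kx).
  rewrite (ExD (int_cst P a) (intZ _ i1)) (ExZ _ i1) Ex_cst.
  rewrite lerD2l -(mulrA (2 * M)) ler_wpM2l ?mulr_ge0 // mulrC.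
  apply: le_trans CK; rewrite ler_wpM2r ?invr_ge0 ?sqr_ge0 //.
  by near: n.
have step2 : `|Ex mu p - Ex P (fun w => p (Z n w))| <= a.
  by near: n; move/cvgrPdist_le: (cvg_trigpoly tp); exact.
have -> : e = (a + 2 * M * a) + a + (a + 2 * M * a).
  by rewrite /a; field; lra.
apply: le_trans (ler_distD (Ex P (fun w => p (Z n w))) _ _) _; rewrite lerD //.
by apply: le_trans (ler_distD (Ex mu p) _ _) _; rewrite lerD.
Unshelve. all: by end_near. Qed.

End Continuity.

(** * The Lindeberg-Feller theorem for positively dependent arrays *)

Section Rows.
Context (d : measure_display) (T : measurableType d) (R : realType).
Variable P : probability T R.
Implicit Types (Y : T -> R) (t : R).

Notation L2 Y := (Y \in Lfun P 2%:E).

Lemma le_norm_complex (z : R[i]) (a : R) : `|z| <= a%:C%C ->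
  `|complex.Re z| <= a /\ `|complex.Im z| <= a.
Proof.
case: z => x y; rewrite normc_def lecR /= => h.
have a0 : 0 <= a by apply: le_trans h; exact: sqrtr_ge0.
have : x ^+ 2 + y ^+ 2 <= a ^+ 2.
  by rewrite -(sqr_sqrtr (addr_ge0 (sqr_ge0 x) (sqr_ge0 y))) lerXn2r ?nnegrE ?sqrtr_ge0.
have := sqr_ge0 x; have := sqr_ge0 y => hy hx hxy.
by split; rewrite -(@ler_pXn2r _ 2) ?nnegrE // real_normK ?num_real //; lra.
Qed.

Lemma norm_prod_sub_le (K : numDomainType) (a b : nat -> K) m :
  (forall j, `|a j| <= 1) -> (forall j, `|b j| <= 1) ->
  `|\prod_(j < m) a j - \prod_(j < m) b j| <= \sum_(j < m) `|a j - b j|.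
Proof.
move=> a1 b1; elim: m => [|m IH]; first by rewrite !big_ord0 subrr normr0.
rewrite !big_ord_recr /=; set A := \prod_(j < m) a j; set B := \prod_(j < m) b j.
have -> : A * a m - B * b m = (A - B) * a m + B * (a m - b m) by ring.
apply: le_trans (ler_normD _ _) _; rewrite !normrM lerD //.
  by rewrite -[leRHS]mulr1 ler_pM.
rewrite ler_piMl // /B normr_prod; apply: prodr_ile1 => j _.
by rewrite normr_ge0 b1.
Qed.

(** Second order expansion: for [|Y| < e] the third order term is at most
    [|t|^3 e Y^2], and for [|Y| >= e] the second order bound is charged to the
    tail. *)
Lemma cf_near_gauss Y t (e dl : R) : L2 Y -> Ex P Y = 0 -> 0 <= e -> Var P Y <= dl ->
  `|cf P Y t - (expR (- (t ^+ 2 / 2 * Var P Y)))%:C%C| <=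
   (`|t| ^+ 3 * e * Var P Y + t ^+ 2 * tail2 P Y e + t ^+ 4 * dl * Var P Y)%:C%C.
Proof.
move=> Y2 Y0 e0 Vdl; have mY := L2_measurable Y2; have iY := L2_int Y2.
have ic := L2_int (L2_cos P t mY); have isn := L2_int (L2_sin P t mY).
have isq := L2_sqr Y2; have V0 := Var_ge0 P Y; have itl := int_tail2 e Y2.
(* bounds both the real and the imaginary part of the error, whence 1/2 *)
pose g w := 2^-1 * (`|t| ^+ 3 * e * Y w ^+ 2 +
                    t ^+ 2 * (Y w ^+ 2 * \1_[set u | e <= `|Y u|] w)).
have ig : integrableRV P g by apply: intZ; apply: intD; apply: intZ.
have Eg : Ex P g = 2^-1 * (`|t| ^+ 3 * e * Var P Y + t ^+ 2 * tail2 P Y e).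
  rewrite (ExZ _ (intD (intZ _ isq) (intZ _ itl))) (ExD (intZ _ isq) (intZ _ itl)).
  by rewrite !ExZ // -Var_mean0.
have bnd w x : x <= (t * Y w) ^+ 2 / 2 -> x <= `|t * Y w| ^+ 3 / 6 -> x <= g w.
  move=> x2 x3; rewrite /g indicE.
  have [_|/negP eY] := boolP (w \in [set u | e <= `|Y u|]).
    apply: le_trans x2 _; rewrite exprMn mulr1 mulrC ler_wpM2l ?invr_ge0 //.
    by rewrite lerDr mulr_ge0 ?sqr_ge0 // mulr_ge0 // exprn_ge0.
  apply: le_trans x3 _; rewrite mulr0 mulr0 addr0 normrM exprMn.
  have Ye : `|Y w| <= e.
    by rewrite leNgt; apply/negP => /ltW h; apply: eY; rewrite inE.
  have -> : Y w ^+ 2 = `|Y w| ^+ 2 by rewrite real_normK ?num_real.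
  have h : `|Y w| ^+ 3 <= e * `|Y w| ^+ 2 by rewrite exprS ler_wpM2r ?sqr_ge0.
  have := ler_wpM2l (exprn_ge0 3 (normr_ge0 t)) h.
  have := mulr_ge0 (exprn_ge0 3 (normr_ge0 t)) (mulr_ge0 e0 (sqr_ge0 `|Y w|)).
  by rewrite -mulrA; lra.
have hc : `|Ex P (fun w => cos (t * Y w)) - 1 + t ^+ 2 / 2 * Var P Y| <= Ex P g.
  rewrite Var_mean0 // -[X in _ - X](Ex_cst P 1) -ExB; [|by []|exact: int_cst].
  rewrite -ExZ // -ExD; [|exact: intB ic (int_cst _ _)|exact: intZ].
  apply: le_norm_Ex => // [|w].
    by apply: intD; [exact: intB ic (int_cst _ _)|exact: intZ].
  have -> : cos (t * Y w) - 1 + t ^+ 2 / 2 * Y w ^+ 2 =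
    cos (t * Y w) - 1 + (t * Y w) ^+ 2 / 2 by rewrite exprMn; ring.
  rewrite ger0_norm ?cos_taylor2_ge0 //.
  by have [] := cos_taylor2_le (t * Y w); exact: bnd.
have hs : `|Ex P (fun w => sin (t * Y w))| <= Ex P g.
  have -> : Ex P (fun w => sin (t * Y w)) = Ex P (fun w => sin (t * Y w) - t * Y w).
    by rewrite ExB ?ExZ ?Y0 ?mulr0 ?subr0 //; exact: intZ.
  apply: le_norm_Ex => // [|w]; first by apply: intB => //; exact: intZ.
  by have [] := sin_sub_le (t * Y w); exact: bnd.
rewrite -[X in `|X|]/(Complex (_ - _) (_ - 0)); apply: normc_le.
rewrite subr0 /=; set V := Var P Y in V0 Vdl Eg hc *.
have y0 : 0 <= t ^+ 2 / 2 * V by rewrite mulr_ge0 // mulr_ge0 ?sqr_ge0.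
have [e1 e2] := expRN_taylor1 y0.
have hV : (t ^+ 2 / 2 * V) ^+ 2 <= t ^+ 4 * dl * V.
  have -> : (t ^+ 2 / 2 * V) ^+ 2 = t ^+ 4 / 4 * (V * V) by field.
  have t4 : 0 <= t ^+ 4 by rewrite (exprM t 2 2) sqr_ge0.
  have := mulr_ge0 t4 (mulr_ge0 (le_trans V0 Vdl) V0).
  have := ler_wpM2l t4 (ler_wpM2r V0 Vdl).
  by rewrite !mulrA; lra.
set c := Ex P _ in hc *; set E := expR _ in e1 e2 *.
have -> : c - E = (c - 1 + t ^+ 2 / 2 * V) - (E - (1 - t ^+ 2 / 2 * V)) by ring.
have := ler_normB (c - 1 + t ^+ 2 / 2 * V) (E - (1 - t ^+ 2 / 2 * V)).
rewrite (ger0_norm e1); move: hs hc Eg; move: (Ex P g) => G; lra.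
Qed.

Lemma prod_cf_near_gauss (Y : nat -> T -> R) m t (e dl : R) :
  (forall j, L2 (Y j)) -> (forall j, Ex P (Y j) = 0) -> 0 <= e ->
  (forall j, (j < m)%N -> Var P (Y j) <= dl) ->
  `|\prod_(j < m) cf P (Y j) t - (expR (- (t ^+ 2 / 2 * \sum_(j < m) Var P (Y j))))%:C%C| <=
   (`|t| ^+ 3 * e * \sum_(j < m) Var P (Y j) + t ^+ 2 * \sum_(j < m) tail2 P (Y j) e
     + t ^+ 4 * dl * \sum_(j < m) Var P (Y j))%:C%C.
Proof.
move=> Y2 Y0 e0 Vdl.
have -> : (expR (- (t ^+ 2 / 2 * \sum_(j < m) Var P (Y j))))%:C%C =
    \prod_(j < m) (expR (- (t ^+ 2 / 2 * Var P (Y j))))%:C%C :> R[i].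
  rewrite -rmorph_prod; congr (_%:C)%C.
  by rewrite -expR_sum mulr_sumr sumrN.
have e1 j : `|(expR (- (t ^+ 2 / 2 * Var P (Y j))))%:C%C : R[i]| <= 1.
  rewrite -[leRHS]/(1%:C%C) normc_def lecR /= expr0n /= addr0 sqrtr_sqr.
  rewrite ger0_norm ?expR_ge0 // -expR0 ler_expR oppr_le0.
  by apply: mulr_ge0; [apply: mulr_ge0; [exact: sqr_ge0|]|exact: Var_ge0].
apply: le_trans (@norm_prod_sub_le _ (fun j => cf P (Y j) t)
  (fun j => (expR (- (t ^+ 2 / 2 * Var P (Y j))))%:C%C) m _ e1) _.
  by move=> j; apply: norm_cf_le1; exact: L2_measurable (Y2 j).
apply: le_trans (_ : \sum_(j < m) (`|t| ^+ 3 * e * Var P (Y j) + t ^+ 2 * tail2 P (Y j) e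
     + t ^+ 4 * dl * Var P (Y j))%:C%C <= _).
  by apply: ler_sum => j _; exact: cf_near_gauss (Y2 j) (Y0 j) e0 (Vdl j (ltn_ord j)).
by rewrite -rmorph_sum lecR !big_split /= -!mulr_sumr.
Qed.

Lemma onem_Ecos_bounds Y t : L2 Y -> Ex P Y = 0 ->
  0 <= 1 - Ex P (fun w => cos (t * Y w)) <= t ^+ 2 / 2 * Var P Y.
Proof.
move=> Y2 Y0; have ic := L2_int (L2_cos P t (L2_measurable Y2)).
have i1 := int_cst P 1; have isq := L2_sqr Y2.
have -> : 1 - Ex P (fun w => cos (t * Y w)) = Ex P (fun w => 1 - cos (t * Y w)).
  by rewrite ExB // Ex_cst.
rewrite Var_mean0 // -(ExZ _ isq).
apply/andP; split; first by apply: Ex_ge0 => w; rewrite subr_ge0 cos_le1.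
apply: le_Ex; [exact: intB|exact: intZ|move=> w].
by have := onem_cos_le_sqr (t * Y w); rewrite exprMn; lra.
Qed.

(** Each factor satisfies [|phi| >= Re phi = 1 - x >= exp (- x / (1 - dl))]. *)
Lemma prod_cf_lower (Y : nat -> T -> R) m t (dl : R) :
  (forall j, L2 (Y j)) -> (forall j, Ex P (Y j) = 0) ->
  (forall j, (j < m)%N -> t ^+ 2 / 2 * Var P (Y j) <= dl) -> dl < 1 ->
  (expR (- ((\sum_(j < m) (1 - Ex P (fun w => cos (t * Y j w)))) / (1 - dl))))%:C%C
    <= `|\prod_(j < m) cf P (Y j) t|.
Proof.
move=> Y2 Y0 Vdl dl1; rewrite mulr_suml -sumrN expR_sum rmorph_prod normr_prod.
apply: ler_prod => j _; rewrite ler0c expR_ge0 /=.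
have /andP[x0 xV] := onem_Ecos_bounds t (Y2 j) (Y0 j).
rewrite normc_def lecR.
apply: le_trans (expR_le_onem x0 (le_trans xV (Vdl j (ltn_ord j))) dl1) _.
rewrite opprB addrC subrK /=; apply: le_trans (ler_norm _) _.
by rewrite -sqrtr_sqr ler_wsqrtr // lerDl sqr_ge0.
Qed.

(** On [|Y| >= e] one has [cos (t Y) - 1 + (t Y)^2 / 2 >= (t^2 / 2 - 2 / e^2) Y^2]. *)
Lemma tail2_le_cos Y t (e : R) : L2 Y -> Ex P Y = 0 -> 0 < e ->
  (t ^+ 2 / 2 - 2 / e ^+ 2) * tail2 P Y e <=
    t ^+ 2 / 2 * Var P Y - (1 - Ex P (fun w => cos (t * Y w))).
Proof.
move=> Y2 Y0 e0; have ic := L2_int (L2_cos P t (L2_measurable Y2)).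
have i1 := int_cst P 1; have isq := L2_sqr Y2; have itl := int_tail2 e Y2.
have -> : 1 - Ex P (fun w => cos (t * Y w)) = Ex P (fun w => 1 - cos (t * Y w)).
  by rewrite ExB // Ex_cst.
rewrite Var_mean0 // -(ExZ _ isq) -(ExZ _ itl) -ExB; [|exact: intZ|exact: intB].
apply: le_Ex; [exact: intZ|by apply: intB; [exact: intZ|exact: intB]|move=> w].
have h := cos_taylor2_ge0 (t * Y w); rewrite exprMn in h.
rewrite indicE; have [/set_mem/= eY|_] := boolP (w \in [set u | e <= `|Y u|]).
  have := cos_geN1 (t * Y w).
  have : 2 <= 2 / e ^+ 2 * Y w ^+ 2.
    rewrite mulrAC ler_pdivlMr ?exprn_gt0 // ler_wpM2l //.
    by rewrite -[leRHS]real_normK ?num_real // lerXn2r ?nnegrE // ltW.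
  by rewrite mulr1 mulrBl; lra.
by rewrite !mulr0; lra.
Qed.

End Rows.

Section Array.
Context (d : measure_display) (T : measurableType d) (R : realType).
Variable P : probability T R.
Variables (Y : nat -> nat -> T -> R) (k : nat -> nat).
Hypothesis Y2 : forall n j, Y n j \in Lfun P 2%:E.
Hypothesis Y0 : forall n j, Ex P (Y n j) = 0.
Hypothesis Ypd : forall n j,
  positively_dependent P (fun w => \sum_(i < j) Y n i w) (Y n j).

Let S n w := \sum_(j < k n) Y n j w.
Let V n := \sum_(j < k n) Var P (Y n j).
Let L e n := \sum_(j < k n) tail2 P (Y n j) e.

Hypothesis VarS1 : Var P (S n) @[n --> \oo] --> (1 : R).
Hypothesis V1 : V n @[n --> \oo] --> (1 : R).

Let S2 n : S n \in Lfun P 2%:E. Proof. exact: L2_sum. Qed.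

Let S0 n : Ex P (S n) = 0.
Proof. by rewrite Ex_sum => [|j]; [exact: big1|exact: L2_int]. Qed.

Let newman_error0 t :
  2 * t ^+ 2 * (Var P (S n) - V n) @[n --> \oo] --> (0 : R).
Proof.
rewrite -[X in _ --> X](mulr0 (2 * t ^+ 2)) -(subrr (1 : R)).
by apply: cvgM; [exact: cvg_cst|exact: cvgB].
Qed.

(** Truncating each summand at level [sqrt (dl / 2)]. *)
Lemma feller_condition_of_lindeberg :
  (forall e : R, 0 < e -> L e n @[n --> \oo] --> (0 : R)) ->
  forall dl : R, 0 < dl -> \forall n \near \oo, forall j, (j < k n)%N -> Var P (Y n j) <= dl.
Proof.
move=> Lind dl dl0; pose e := Num.sqrt (dl / 2).
have dl20 : 0 < dl / 2 by rewrite divr_gt0.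
have e0 : 0 < e by rewrite sqrtr_gt0.
near=> n; move=> j jk; rewrite Var_mean0 //.
apply: le_trans (sqr_le_tail2 (ltW e0) (Y2 n j)) _.
rewrite sqr_sqrtr ?(ltW dl20) // [leRHS]splitr lerD2l.
apply: le_trans (_ : L e n <= _).
  rewrite /L (bigD1 (Ordinal jk)) //= lerDl; apply: sumr_ge0 => i _; exact: tail2_ge0.
by near: n; apply: (cvgr_le _ (Lind e e0)).
Unshelve. all: by end_near. Qed.

(** The three errors come from Newman's inequality, from the expansion of the
    factors, and from replacing the sum [V n] of the variances by its limit. *)
Lemma cvg_cf_of_lindeberg t :
  (forall e : R, 0 < e -> L e n @[n --> \oo] --> (0 : R)) ->
  forall e : R, 0 < e -> \forall n \near \oo,
    `|cf P (S n) t - (expR (- t ^+ 2 / 2))%:C%C| <= e%:C%C.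
Proof.
move=> Lind e e0.
(* serves as truncation level and as bound of the variances; the limit
   (|t|^3 + t^4) a of the error is then less than e *)
pose a := e / (2 * (`|t| ^+ 3 + t ^+ 4 + 1)).
have t3 : 0 <= `|t| ^+ 3 by rewrite exprn_ge0.
have t4 : 0 <= t ^+ 4 by rewrite (exprM t 2 2) sqr_ge0.
have a0 : 0 < a by rewrite divr_gt0 // mulr_gt0 //; lra.
pose B n := 2 * t ^+ 2 * (Var P (S n) - V n) +
  (`|t| ^+ 3 * a * V n + t ^+ 2 * L a n + t ^+ 4 * a * V n) +
  `|expR (- (t ^+ 2 / 2 * V n)) - expR (- t ^+ 2 / 2)|.
have cB : B n @[n --> \oo] --> 0 + (`|t| ^+ 3 * a * 1 + t ^+ 2 * 0 + t ^+ 4 * a * 1) + 0.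
  have cst_cvg (c : R) (u : nat -> R) l : u n @[n --> \oo] --> l -> c * u n @[n --> \oo] --> c * l.
    by move=> ul; apply: cvgM => //; exact: cvg_cst.
  apply: cvgD; first apply: cvgD; first exact: newman_error0.
    by apply: cvgD; [apply: cvgD|]; apply: cst_cvg => //; exact: Lind.
  suff : `|expR (- (t ^+ 2 / 2 * V n)) - expR (- t ^+ 2 / 2)| @[n --> \oo] -->
      `|expR (- t ^+ 2 / 2) - expR (- t ^+ 2 / 2)| by rewrite subrr normr0.
  apply: cvg_norm; apply: cvgB; last exact: cvg_cst.
  have -> : - t ^+ 2 / 2 = - (t ^+ 2 / 2 * 1) by rewrite mulr1 mulNr.
  by apply: (continuous_cvg _ (@continuous_expR R _)); apply: cvgN; exact: cst_cvg.
have Be : \forall n \near \oo, B n <= e.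
  apply: (cvgr_le _ cB).
  rewrite mulr0 !mulr1 !addr0 add0r -mulrDl /a mulrA ltr_pdivrMr; last by lra.
  by rewrite mulrC ltr_pM2l //; lra.
have uan := feller_condition_of_lindeberg Lind a0.
near=> n.
have Bn : B n <= e by near: n.
have un : forall j, (j < k n)%N -> Var P (Y n j) <= a by near: n.
apply: (@le_trans _ _ (B n)%:C%C); last by rewrite lecR.
have h1 := newman (k n) t (Y2 n) (@Ypd n).
have h2 := prod_cf_near_gauss t (Y2 n) (Y0 n) (ltW a0) un.
have -> : (B n)%:C%C = (2 * t ^+ 2 * (Var P (S n) - V n))%:C%C +
    (`|t| ^+ 3 * a * V n + t ^+ 2 * L a n + t ^+ 4 * a * V n)%:C%C +
    (`|expR (- (t ^+ 2 / 2 * V n)) - expR (- t ^+ 2 / 2)|)%:C%C :> R[i].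
  by rewrite -!rmorphD.
pose E : R[i] := (expR (- (t ^+ 2 / 2 * V n)))%:C%C.
have -> : cf P (S n) t - (expR (- t ^+ 2 / 2))%:C%C =
   (cf P (S n) t - \prod_(j < k n) cf P (Y n j) t) +
   (\prod_(j < k n) cf P (Y n j) t - E) + (E - (expR (- t ^+ 2 / 2))%:C%C) by ring.
apply: le_trans (ler_normD _ _) _; apply: lerD.
  apply: le_trans (ler_normD _ _) _; apply: lerD; first exact: h1.
  exact: h2.
by rewrite /E -rmorphB normc_def /= expr0n /= addr0 sqrtr_sqr.
Unshelve. all: by end_near. Qed.

Lemma clt_of_lindeberg :
  (forall e : R, 0 < e -> L e n @[n --> \oo] --> (0 : R)) ->
  cvg_weakly P S (normal_prob (0 : R) 1).
Proof.
move=> Lind; have cfS t := cvg_cf_of_lindeberg t Lind.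
apply: (@cvg_weakly_of_cf _ _ _ P (normal_prob (0 : R) 1) S _ _ _ 2) => //.
- by move=> n; exact: L2_measurable (S2 n).
- move=> t; rewrite normal_Ecos; apply/cvgrPdist_le => e e0.
  near=> n; rewrite distrC.
  have /le_norm_complex[] : `|cf P (S n) t - (expR (- t ^+ 2 / 2))%:C%C| <= e%:C%C.
    by near: n; exact: cfS.
  by [].
- move=> t; rewrite normal_Esin; apply/cvgrPdist_le => e e0.
  near=> n; rewrite distrC.
  have /le_norm_complex[] : `|cf P (S n) t - (expR (- t ^+ 2 / 2))%:C%C| <= e%:C%C.
    by near: n; exact: cfS.
  by [].
- near=> n; rewrite -Var_mean0 //; near: n; apply: (cvgr_le _ VarS1).
  by rewrite ltr1n.
Unshelve. all: by end_near. Qed.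

Lemma Ex_of_cvg_weakly (f : R -> R) (M : R) : continuous f -> (forall x, `|f x| <= M) ->
  cvg_weakly P S (normal_prob (0 : R) 1) ->
  Ex P (fun w => f (S n w)) @[n --> \oo] --> Ex (normal_prob (0 : R) 1) f.
Proof.
move=> cf fM /(_ f cf (ex_intro _ M fM)).
have ifm : integrableRV (normal_prob (0 : R) 1) f :=
  int_comp_bounded (normal_prob (0 : R) 1) cf fM (@measurable_id _ _ setT).
have -> : (\int[normal_prob 0 1]_x (f x)%:E)%E = (Ex (normal_prob (0 : R) 1) f)%:E.
  by rewrite (EFin_Ex ifm) unlock.
by move=> /fine_cvgP[].
Qed.

(** The characteristic function of the sum tends to [e^(-t^2/2)], and the
    product of the [|phi_j|] is at least about [exp (- sum_j (1 - Re phi_j))].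
    Hence [sum_j (1 - Re phi_j)], which is at most [t^2/2 V], is
    asymptotically not smaller than [t^2/2], and the tails are controlled by
    the difference. *)
Lemma lindeberg_of_clt :
  (forall dl : R, 0 < dl ->
    \forall n \near \oo, forall j, (j < k n)%N -> Var P (Y n j) <= dl) ->
  cvg_weakly P S (normal_prob (0 : R) 1) ->
  forall e : R, 0 < e -> L e n @[n --> \oo] --> (0 : R).
Proof.
move=> uan clt e e0.
have L0 n : 0 <= L e n by apply: sumr_ge0 => j _; exact: tail2_ge0.
(* makes the factor t^2/2 - 2/e^2 of the tails equal to 1 *)
pose t := Num.sqrt (4 / e ^+ 2 + 2).
have t2 : t ^+ 2 = 4 / e ^+ 2 + 2.
  by rewrite sqr_sqrtr // addr_ge0 // divr_ge0 // sqr_ge0.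
have t20 : 0 < t ^+ 2 by rewrite t2 ltr_wpDl // divr_ge0 // sqr_ge0.
have t2e : t ^+ 2 / 2 - 2 / e ^+ 2 = 1.
  by rewrite t2; field; rewrite gt_eqF.
have clin : continuous (fun x : R => t * x).
  by move=> x; apply: cvgM; [exact: cvg_cst|exact: cvg_id].
have ccos : continuous (fun x : R => cos (t * x)).
  by move=> x; apply: (continuous_comp (clin x)); exact: continuous_cos.
have csin : continuous (fun x : R => sin (t * x)).
  by move=> x; apply: (continuous_comp (clin x)); exact: continuous_sin.
have := Ex_of_cvg_weakly csin (fun x => sin_max _) clt.
have := Ex_of_cvg_weakly ccos (fun x => cos_max _) clt.
rewrite normal_Ecos normal_Esin => limc lims.
(* an upper bound of the modulus of the product, by Newman's inequality *)
pose A n := `|Ex P (fun w => cos (t * S n w))| + `|Ex P (fun w => sin (t * S n w))|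
  + 2 * t ^+ 2 * (Var P (S n) - V n).
have limA : A n @[n --> \oo] --> expR (- t ^+ 2 / 2).
  suff : A n @[n --> \oo] --> `|expR (- t ^+ 2 / 2)| + `|0 : R| + 0.
    by rewrite normr0 !addr0 ger0_norm // expR_ge0.
  by apply: cvgD; [apply: cvgD; exact: cvg_norm|exact: newman_error0].
have limlnA : ln (A n) @[n --> \oo] --> - t ^+ 2 / 2.
  by rewrite -[X in _ --> X]expRK; apply: (continuous_cvg _ (continuous_ln (expR_gt0 _))).
apply/cvgrPdist_le => a a0.
(* bounds the x_j; the limit of the upper bound of L e n is eta t^2/2 *)
pose eta := Num.min (1 / 2) (a / t ^+ 2).
have eta0 : 0 < eta by rewrite lt_min divr_gt0 // divr_gt0.
have eta1 : eta < 1 by rewrite gt_min; apply/orP; left; lra.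
have etaa : eta * (t ^+ 2 / 2) < a.
  have : eta <= a / t ^+ 2 by rewrite ge_min lexx orbT.
  by rewrite ler_pdivlMr // mulrA; lra.
have bound : \forall n \near \oo, t ^+ 2 / 2 * V n + (1 - eta) * ln (A n) <= a.
  have : t ^+ 2 / 2 * V n + (1 - eta) * ln (A n) @[n --> \oo] -->
      t ^+ 2 / 2 * 1 + (1 - eta) * (- t ^+ 2 / 2).
    by apply: cvgD; apply: cvgM => //; exact: cvg_cst.
  move/cvgr_le; apply; apply: le_lt_trans etaa.
  by rewrite le_eqVlt; apply/orP; left; apply/eqP; field.
have dl0 : 0 < 2 * eta / t ^+ 2 by rewrite divr_gt0 // mulr_gt0.
near=> n; rewrite sub0r normrN ger0_norm //.
apply: le_trans (_ : t ^+ 2 / 2 * V n + (1 - eta) * ln (A n) <= _); last by near: n.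
pose X := \sum_(j < k n) (1 - Ex P (fun w => cos (t * Y n j w))).
have LX : L e n <= t ^+ 2 / 2 * V n - X.
  rewrite /V /X mulr_sumr -sumrB; apply: ler_sum => j _.
  by have := tail2_le_cos t (Y2 n j) (Y0 n j) e0; rewrite t2e mul1r.
apply: le_trans LX _; rewrite lerD2l.
have lower : (expR (- (X / (1 - eta))))%:C%C <= `|\prod_(j < k n) cf P (Y n j) t|.
  apply: prod_cf_lower => // j jk.
  have : Var P (Y n j) <= 2 * eta / t ^+ 2.
    by move: j jk; near: n; exact: uan.
  by rewrite ler_pdivlMr //; lra.
have AE : expR (- (X / (1 - eta))) <= A n.
  rewrite -lecR; apply: le_trans lower _.
  rewrite -[\prod_(j < k n) _](subrK (cf P (S n) t)) addrC.
  apply: le_trans (ler_normD _ _) _; rewrite rmorphD; apply: lerD.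
    by apply: normc_le.
  by rewrite distrC; exact: newman.
have A0 : 0 < A n by apply: lt_le_trans AE; exact: expR_gt0.
move: AE; rewrite -(ler_ln (expR_gt0 _) A0) expRK.
have eta1' : 0 < 1 - eta by lra.
by rewrite -mulNr ler_pdivrMr // mulrC.
Unshelve. all: by end_near. Qed.

(** The Lindeberg-Feller theorem without independence: positive dependence
    and the agreement in the limit of the variance of the sum with the sum of
    the variances replace it. *)
Theorem lindeberg_feller :
  ((forall dl : R, 0 < dl ->
    \forall n \near \oo, forall j, (j < k n)%N -> Var P (Y n j) <= dl)
    /\ cvg_weakly P (fun n w => \sum_(j < k n) Y n j w) (normal_prob (0 : R) 1)) <->
  forall e : R, 0 < e -> \sum_(j < k n) tail2 P (Y n j) e @[n --> \oo] --> (0 : R).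
Proof.
split=> [[uan clt]|Lind]; first exact: lindeberg_of_clt.
by split; [exact: feller_condition_of_lindeberg|exact: clt_of_lindeberg].
Qed.

End Array.

(** * Blocks of an associated sequence *)

Section Blocks.
Context (d : measure_display) (T : measurableType d) (R : realType).
Variable P : probability T R.

Lemma positively_dependent_scale (U V : T -> R) (a : R) : 0 <= a ->
  positively_dependent P U V ->
  positively_dependent P (fun w => a * U w) (fun w => a * V w).
Proof.
move=> a0 UV F G mF mG; apply: (UV (fun x => F (a * x)) (fun x => G (a * x))).
- by move=> x y xy; apply: mF; rewrite ler_wpM2l.
- by move=> x y xy; apply: mG; rewrite ler_wpM2l.
Qed.

(** The covariances that appear in the variance of the sum are nonnegative. *)
Lemma sum_Var_le (D : nat -> T -> R) m :
  (forall j, D j \in Lfun P 2%:E) ->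
  (forall j, positively_dependent P (fun w => \sum_(i < j) D i w) (D j)) ->
  \sum_(j < m) Var P (D j) <= Var P (fun w => \sum_(j < m) D j w).
Proof.
move=> D2 Dpd; elim: m => [|m IH]; first by rewrite big_ord0 Var_ge0.
have S2 : (fun w => \sum_(j < m) D j w) \in Lfun P 2%:E by exact: L2_sum.
rewrite (_ : (fun w => _) = fun w => \sum_(j < m) D j w + D m w); last first.
  by apply/funext => w; rewrite big_ord_recr.
rewrite big_ord_recr /= VarD //.
by have := Cov_ge0 (Dpd m) S2 (D2 m); lra.
Qed.

Lemma tail2_scale (Y : T -> R) (a e : R) : 0 < a -> Y \in Lfun P 2%:E ->
  tail2 P (fun w => a * Y w) e = a ^+ 2 * tail2 P Y (e / a).
Proof.
move=> a0 Y2; rewrite -(ExZ _ (int_tail2 _ Y2)); apply: eq_Ex => w.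
rewrite exprMn mulrA; congr (_ * \1_ _ _); apply/funext => u /=.
by rewrite normrM gtr0_norm // mulrC ler_pdivrMr // mulrC.
Qed.

Variable X : nat -> T -> R.
Hypothesis X_assoc : associated_sequence P X.
Hypothesis X2 : forall i, X i \in Lfun P 2%:E.
Hypothesis X0 : forall i, Ex P (X i) = 0.

Lemma L2_psum n : psum X n \in Lfun P 2%:E.
Proof. by apply: L2_sum => i; exact: X2. Qed.

Lemma Ex_psum n : Ex P (psum X n) = 0.
Proof. by rewrite Ex_sum => [|j]; [exact: big1|exact: L2_int]. Qed.

(** The partial sum and the increment are nondecreasing functions of disjoint
    groups of the coordinates [X_0, ..., X_(q-1)]. *)
Lemma psum_increment_pd p q : (p <= q)%N ->
  positively_dependent P (psum X p) (fun w => psum X q w - psum X p w).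
Proof.
move=> pq F G mF mG FU2 GV2.
have pE w : psum X p w = \sum_(i < q | (i < p)%N) X i w.
  by rewrite /psum (big_ord_widen q (fun i => X i w) pq).
have qE w : psum X q w - psum X p w = \sum_(i < q | ~~ (i < p)%N) X i w.
  by rewrite pE /psum (bigID (fun i : 'I_q => (i < p)%N)) /= addrAC subrr add0r.
pose h (x : 'rV[R]_q) := F (\sum_(i < q | (i < p)%N) x ord0 i).
pose g (x : 'rV[R]_q) := G (\sum_(i < q | ~~ (i < p)%N) x ord0 i).
have hE : (fun w => h (\row_i X (nat_of_ord i) w)) = F \o psum X p.
  by apply/funext => w; rewrite /h /= pE; congr F; apply: eq_bigr => i _; rewrite mxE.
have gE : (fun w => g (\row_i X (nat_of_ord i) w)) = G \o (fun w => psum X q w - psum X p w).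
  by apply/funext => w; rewrite /g /= qE; congr G; apply: eq_bigr => i _; rewrite mxE.
have := @X_assoc q (@nat_of_ord q) (@ord_inj q) h g.
rewrite /= hE gE => cov; apply: fine_ge0; apply: cov.
- by move=> x y xy; apply: mF; exact: ler_sum.
- by move=> x y xy; apply: mG; exact: ler_sum.
- by split; [exact: L2_int|exact: L2_int|exact: L2_mul].
Qed.

(** Increments of the partial sums along [0, l, 2 l, ..., m l, n]: the blocks,
    followed by the remainder. *)
Definition cut (l n j : nat) : nat := minn (j * l) n.
Definition increment (l n j : nat) : T -> R :=
  fun w => psum X (cut l n j.+1) w - psum X (cut l n j) w.

Lemma sum_increment l n k w :
  \sum_(j < k) increment l n j w = psum X (cut l n k) w.
Proof.
elim: k => [|k IH]; first by rewrite big_ord0 /cut mul0n min0n /psum big_ord0.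
by rewrite big_ord_recr /= IH /increment addrC subrK.
Qed.

Lemma L2_increment l n j : increment l n j \in Lfun P 2%:E.
Proof. by apply: L2B; exact: L2_psum. Qed.

Lemma Ex_increment l n j : Ex P (increment l n j) = 0.
Proof. by rewrite ExB ?Ex_psum ?subrr //; apply: L2_int; exact: L2_psum. Qed.

Lemma cut_le l n j : (cut l n j <= cut l n j.+1)%N.
Proof. by rewrite /cut leq_min geq_minr andbT geq_min leq_mul2r leqnSn orbT. Qed.

Lemma increment_pd l n j : positively_dependent P
  (fun w => \sum_(i < j) increment l n i w) (increment l n j).
Proof.
rewrite (_ : (fun w => _) = psum X (cut l n j)).
  exact: psum_increment_pd (cut_le _ _ _).
by apply/funext => w; exact: sum_increment.
Qed.

End Blocks.

Lemma cvg_eq_near (R : realType) (f g : nat -> R) (a : R) :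
  (\forall n \near \oo, f n = g n) -> g n @[n --> \oo] --> a -> f n @[n --> \oo] --> a.
Proof. by move=> fg; apply: cvg_trans; exact: near_eq_cvg (filterS (fun _ => esym) fg). Qed.

Section BlockCLT.
Context (d : measure_display) (T : measurableType d) (R : realType).
Variable P : probability T R.
Variables (X : nat -> T -> R) (l m : nat -> nat).
Hypothesis X_assoc : associated_sequence P X.
Hypothesis X2 : forall i, X i \in Lfun P 2%:E.
Hypothesis X0 : forall i, Ex P (X i) = 0.
Hypothesis s_gt0 : \forall n \near \oo, 0 < s P X n.
Hypothesis lm_n : forall n, (0 < n)%N -> (m n * l n <= n <= (m n).+1 * l n)%N.
Hypothesis nu2_s2 : (s2 P X n)^-1 * nu2 P X (l n) (m n) @[n --> \oo] --> (1 : R).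

Let k n := (m n).+1.
Let Y n j : T -> R := fun w => (s P X n)^-1 * increment X (l n) n j w.
Let Y2 n j : Y n j \in Lfun P 2%:E.
Proof. by apply: L2Z; exact: L2_increment. Qed.

Let Y0 n j : Ex P (Y n j) = 0.
Proof. by rewrite ExZ ?Ex_increment ?mulr0 //; apply: L2_int; exact: L2_increment. Qed.

Let Y_sum n p w : \sum_(j < p) Y n j w = (s P X n)^-1 * psum X (cut (l n) n p) w.
Proof. by rewrite -mulr_sumr sum_increment. Qed.

Let Y_pd n j : positively_dependent P (fun w => \sum_(i < j) Y n i w) (Y n j).
Proof.
rewrite (_ : (fun w => _) = fun w => (s P X n)^-1 * \sum_(i < j) increment X (l n) n i w).
  apply: positively_dependent_scale; first by rewrite invr_ge0 sqrtr_ge0.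
  exact: increment_pd.
by apply/funext => w; rewrite mulr_sumr.
Qed.

Let cut_block n j : (0 < n)%N -> (j <= m n)%N -> cut (l n) n j = (j * l n)%N.
Proof.
move=> n0 jm; apply/minn_idPl; have /andP[+ _] := lm_n n0.
by apply: leq_trans; rewrite leq_mul2r jm orbT.
Qed.

Let cut_last n : cut (l n) n (k n) = n.
Proof. by apply/minn_idPr; case: n => // n; have /andP[] := lm_n (ltn0Sn n). Qed.

Let increment_block n j : (0 < n)%N -> (j < m n)%N ->
  increment X (l n) n j = block X (l n) j.+1.
Proof. by move=> n0 jm; apply/funext => w; rewrite /increment !cut_block // ltnW. Qed.

Let Y_total n w : \sum_(j < k n) Y n j w = psum X n w / s P X n.
Proof. by rewrite Y_sum cut_last mulrC. Qed.

Let s2E n : (s P X n) ^+ 2 = s2 P X n.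
Proof. by rewrite /s sqr_sqrtr // Var_ge0. Qed.

Let s2_ge0 n : 0 <= s2 P X n. Proof. exact: Var_ge0. Qed.

Let Var_Y n j : Var P (Y n j) = (s2 P X n)^-1 * Var P (increment X (l n) n j).
Proof. by rewrite VarZ ?exprVn ?s2E //; exact: L2_increment. Qed.

Let V_split n : (0 < n)%N -> \sum_(j < k n) Var P (Y n j) =
  (s2 P X n)^-1 * nu2 P X (l n) (m n) + Var P (Y n (m n)).
Proof.
move=> n0; rewrite big_ord_recr /=; congr (_ + _).
rewrite /nu2 big_add1 big_mkord mulr_sumr; apply: eq_bigr => j _.
by rewrite Var_Y increment_block.
Qed.

Let V_le1 : \forall n \near \oo, \sum_(j < k n) Var P (Y n j) <= 1.
Proof.
near=> n.
have sn : 0 < s P X n by near: n.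
apply: le_trans (sum_Var_le (k n) (Y2 n) (@Y_pd n)) _.
rewrite (_ : (fun w => _) = fun w => (s P X n)^-1 * psum X n w); last first.
  by apply/funext => w; rewrite Y_total mulrC.
by rewrite VarZ ?L2_psum // exprVn s2E mulVf // -s2E expf_neq0 // gt_eqF.
Unshelve. all: by end_near. Qed.

Let nu2_le_s2 : \forall n \near \oo, nu2 P X (l n) (m n) <= s2 P X n.
Proof.
near=> n.
have n0 : (0 < n)%N by near: n; exact: nbhs_infty_gt.
have sn : 0 < s P X n by near: n.
have s2n : 0 < s2 P X n by rewrite -s2E exprn_gt0.
have : \sum_(j < k n) Var P (Y n j) <= 1 by near: n; exact: V_le1.
rewrite V_split // mulrC => h.
by rewrite -[leRHS]mul1r -ler_pdivrMr //; have := Var_ge0 P (Y n (m n)); lra.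
Unshelve. all: by end_near. Qed.

(** [nu^2 + Var (remainder) <= s^2], and [nu^2 / s^2] tends to [1]: the last
    increment, which is the remainder, is negligible. *)
Let Var_rem0 : Var P (Y n (m n)) @[n --> \oo] --> (0 : R).
Proof.
have : 1 - (s2 P X n)^-1 * nu2 P X (l n) (m n) @[n --> \oo] --> (1 - 1 : R).
  by apply: cvgB => //; exact: cvg_cst.
rewrite subrr => h; apply: (squeeze_cvgr _ (cvg_cst 0) h).
near=> n; rewrite Var_ge0 /=.
have n0 : (0 < n)%N by near: n; exact: nbhs_infty_gt.
have : \sum_(j < k n) Var P (Y n j) <= 1 by near: n; exact: V_le1.
by rewrite V_split //; lra.
Unshelve. all: by end_near. Qed.

Let V1 : \sum_(j < k n) Var P (Y n j) @[n --> \oo] --> (1 : R).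
Proof.
have : (s2 P X n)^-1 * nu2 P X (l n) (m n) + Var P (Y n (m n)) @[n --> \oo] --> (1 + 0 : R).
  exact: cvgD.
rewrite addr0; apply: cvg_eq_near.
near=> n; have n0 : (0 < n)%N by near: n; exact: nbhs_infty_gt.
by rewrite V_split.
Unshelve. all: by end_near. Qed.

Let VarS1 : Var P (fun w => \sum_(j < k n) Y n j w) @[n --> \oo] --> (1 : R).
Proof.
apply: cvg_near_cst; near=> n.
have sn : 0 < s P X n by near: n.
rewrite (_ : (fun w => _) = fun w => (s P X n)^-1 * psum X n w); last first.
  by apply/funext => w; rewrite Y_total mulrC.
by rewrite VarZ ?L2_psum // exprVn s2E mulVf // -s2E expf_neq0 // gt_eqF.
Unshelve. all: by end_near. Qed.

(** The row [Y n] has one more entry than there are blocks, the negligible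
    remainder. *)
Lemma block_uan_iff :
  \big[Num.max/0]_(1 <= j < (m n).+1)
    (Ex P (fun w => block X (l n) j w ^+ 2) / s2 P X n) @[n --> \oo] --> (0 : R)
  <-> forall dl : R, 0 < dl ->
        \forall n \near \oo, forall j, (j < k n)%N -> Var P (Y n j) <= dl.
Proof.
have FE n (j : 'I_(m n)) : (0 < n)%N -> Ex P (fun w => block X (l n) j.+1 w ^+ 2) / s2 P X n = Var P (Y n j).
  move=> n0; rewrite Var_Y mulrC increment_block // Var_mean0 //.
    by rewrite -increment_block //; exact: L2_increment.
  by rewrite -increment_block //; exact: Ex_increment.
have maxE n : (0 < n)%N -> \big[Num.max/0]_(1 <= j < (m n).+1)
    (Ex P (fun w => block X (l n) j w ^+ 2) / s2 P X n) =
    \big[Num.max/0]_(j < m n) Var P (Y n j).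
  by move=> n0; rewrite big_add1 big_mkord; apply: eq_bigr => j _; exact: FE.
split=> [h dl dl0|h].
  near=> n; have n0 : (0 < n)%N by near: n; exact: nbhs_infty_gt.
  move=> j; rewrite ltnS leq_eqVlt => /orP[/eqP ->|jm].
    by near: n; apply: (cvgr_le _ Var_rem0).
  apply: (@le_trans _ _ (\big[Num.max/0]_(i < m n) Var P (Y n i))).
    exact: (le_bigmax _ (fun i : 'I_(m n) => Var P (Y n i)) (Ordinal jm)).
  by rewrite -maxE //; near: n; apply: (cvgr_le _ h).
apply/cvgrPdist_le => dl dl0; near=> n.
have n0 : (0 < n)%N by near: n; exact: nbhs_infty_gt.
rewrite maxE // sub0r normrN ger0_norm; last exact: bigmax_ge_id.
apply: bigmax_le => [|j _]; first exact: ltW.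
have : forall j, (j < k n)%N -> Var P (Y n j) <= dl by near: n; exact: h.
by apply; rewrite ltnS ltnW.
Unshelve. all: by end_near. Qed.

Let Lsum (c : nat -> R) n := (s2 P X n)^-1 *
  \sum_(1 <= j < (m n).+1) tail2 P (block X (l n) j) (c n).

Let L2_block n j : block X (l n) j \in Lfun P 2%:E.
Proof. by apply: L2B; exact: L2_psum. Qed.

Let Lsum_ge0 c n : 0 <= Lsum c n.
Proof.
rewrite mulr_ge0 ?invr_ge0 //.
by rewrite big_add1 big_mkord; apply: sumr_ge0 => j _; exact: tail2_ge0.
Qed.

Let Lsum_le c c' n : c n <= c' n -> Lsum c' n <= Lsum c n.
Proof.
move=> cc'; rewrite ler_wpM2l ?invr_ge0 //.
by rewrite !big_add1 !big_mkord; apply: ler_sum => j _; exact: tail2_le.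
Qed.

(** The tail of the remainder is at most its variance. *)
Lemma block_lindeberg_iff :
  (forall e : R, 0 < e -> Lsum (fun n => e * s P X n) n @[n --> \oo] --> (0 : R)) <->
  (forall e : R, 0 < e -> \sum_(j < k n) tail2 P (Y n j) e @[n --> \oo] --> (0 : R)).
Proof.
have split_n e : \forall n \near \oo, \sum_(j < k n) tail2 P (Y n j) e =
    Lsum (fun n => e * s P X n) n + tail2 P (Y n (m n)) e.
  near=> n; have sn : 0 < s P X n by near: n.
  have n0 : (0 < n)%N by near: n; exact: nbhs_infty_gt.
  rewrite big_ord_recr /=; congr (_ + _).
  rewrite /Lsum big_add1 big_mkord mulr_sumr; apply: eq_bigr => j _.
  rewrite tail2_scale ?invr_gt0 //; last exact: L2_increment.
  by rewrite exprVn s2E invrK increment_block.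
have rem0 e : tail2 P (Y n (m n)) e @[n --> \oo] --> (0 : R).
  apply: (squeeze_cvgr _ (cvg_cst 0) Var_rem0); apply: nearW => n.
  by rewrite tail2_ge0 Var_mean0 //= tail2_le_sqr.
split=> h e e0.
  have : Lsum (fun n => e * s P X n) n + tail2 P (Y n (m n)) e @[n --> \oo] --> (0 + 0 : R).
    by apply: cvgD; [exact: h|exact: rem0].
  by rewrite addr0; exact: cvg_eq_near.
apply: (squeeze_cvgr _ (cvg_cst 0) (h e e0)).
near=> n; rewrite Lsum_ge0 /=.
have -> : \sum_(j < k n) tail2 P (Y n j) e =
    Lsum (fun n => e * s P X n) n + tail2 P (Y n (m n)) e by near: n; exact: split_n.
by rewrite lerDl tail2_ge0.
Unshelve. all: by end_near. Qed.

(** Eventually [s / 2 <= nu <= s], and tails decrease with the level. *)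
Lemma block_lindeberg_nu_s :
  (forall e : R, 0 < e -> Lsum (fun n => e * nu P X (l n) (m n)) n @[n --> \oo] --> (0 : R)) <->
  (forall e : R, 0 < e -> Lsum (fun n => e * s P X n) n @[n --> \oo] --> (0 : R)).
Proof.
split=> h e e0.
  apply: (squeeze_cvgr _ (cvg_cst 0) (h e e0)).
  near=> n; rewrite Lsum_ge0 /=; apply: Lsum_le.
  rewrite ler_wpM2l ?(ltW e0) // /nu /s ler_wsqrtr //.
  by near: n; exact: nu2_le_s2.
have e20 : 0 < e / 2 by rewrite divr_gt0.
apply: (squeeze_cvgr _ (cvg_cst 0) (h _ e20)).
near=> n; rewrite Lsum_ge0 /=; apply: Lsum_le.
have sn : 0 < s P X n by near: n.
have s2n : 0 < s2 P X n by rewrite -s2E exprn_gt0.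
rewrite -mulrA ler_wpM2l ?(ltW e0) //.
rewrite -(@ler_pXn2r _ 2) ?nnegrE ?mulr_ge0 ?invr_ge0 ?sqrtr_ge0 // ?(ltW sn) //.
have : 1 / 4 <= (s2 P X n)^-1 * nu2 P X (l n) (m n).
  by near: n; apply: (cvgr_ge _ nu2_s2); lra.
rewrite [X in _ <= X]mulrC ler_pdivlMr // => h4.
rewrite exprMn s2E /nu sqr_sqrtr; last first.
  by rewrite /nu2 big_add1 big_mkord; apply: sumr_ge0 => j _; exact: Var_ge0.
by apply: le_trans h4; rewrite le_eqVlt; apply/orP; left; apply/eqP; field.
Unshelve. all: by end_near. Qed.

Lemma block_clt :
  ((\big[Num.max/0]_(1 <= j < (m n).+1)
      (Ex P (fun w => block X (l n) j w ^+ 2) / s2 P X n) @[n --> \oo] --> (0 : R))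
    /\ cvg_weakly P (fun n w => psum X n w / s P X n) (normal_prob (0 : R) 1)) <->
  forall e : R, 0 < e -> Lsum (fun n => e * s P X n) n @[n --> \oo] --> (0 : R).
Proof.
rewrite block_lindeberg_iff block_uan_iff -(lindeberg_feller Y2 Y0 Y_pd VarS1 V1).
rewrite (_ : (fun n w => psum X n w / s P X n) = fun n w => \sum_(j < k n) Y n j w) //.
by apply/funext => n; apply/funext => w; rewrite Y_total.
Qed.

End BlockCLT.

Unset Implicit Arguments.

Theorem theorem5 (d : measure_display) (T : measurableType d) (R : realType)
    (P : probability T R) (X : nat -> {RV P >-> R}) (l m r : nat -> nat)
    (X_assoc : associated_sequence P (fun i => X i : T -> R))
    (X_L2 : forall i, (X i : T -> R) \in Lfun P 2%:E)
    (X_mean0 : forall i, 'E_P[X i]%E = 0%E)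
    (s_gt0 : \forall n \near \oo, 0 < s P X n)
    (l_gt0 : forall n, (0 < n)%N -> (0 < l n)%N)
    (n_eq : forall n, (0 < n)%N -> n = (m n * l n + r n)%N)
    (r_lt : forall n, (0 < n)%N -> (r n < l n)%N)
    (m_oo : m n @[n --> \oo] --> \oo)
    (l_o : (l n)%:R / n%:R @[n --> \oo] --> (0 : R))
    (r_o : (r n)%:R / n%:R @[n --> \oo] --> (0 : R))
    (var_sum :
      (l n)%:R / s2 P X n *
        \sum_(1 <= j < (m n).+1)
          Var P (fun w => block X (l n) j w / Num.sqrt (l n)%:R)
        @[n --> \oo] --> (1 : R))
    (remainder :
      (s2 P X n)^-1 * Var P (fun w => \sum_(m n * l n <= i < n) X i w)
        @[n --> \oo] --> (0 : R)
      \/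
      \big[Num.max/0]_(1 <= j < (m n).+2)
        ((l n)%:R / s2 P X n *
          Var P (fun w => block X (l n) j w / Num.sqrt (l n)%:R))
        @[n --> \oo] --> (0 : R)) :
  let uan_and_clt :=
    (\big[Num.max/0]_(1 <= j < (m n).+1)
        (Ex P (fun w => block X (l n) j w ^+ 2) / s2 P X n)
        @[n --> \oo] --> (0 : R))
    /\ cvg_weakly P (fun n w => psum X n w / s P X n)
         (normal_prob (0 : R) 1) in
  (uan_and_clt <->
    forall eps : R, 0 < eps ->
      (s2 P X n)^-1 * \sum_(1 <= j < (m n).+1)
          tail2 P (block X (l n) j) (eps * nu P X (l n) (m n))
        @[n --> \oo] --> (0 : R))
  /\
  (uan_and_clt <->
    forall eps : R, 0 < eps ->
      (s2 P X n)^-1 * \sum_(1 <= j < (m n).+1)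
          tail2 P (block X (l n) j) (eps * s P X n)
        @[n --> \oo] --> (0 : R)).
Proof.
move=> uan_and_clt.
pose Xf i : T -> R := X i.
have X0 i : Ex P (Xf i) = 0 by rewrite /Ex X_mean0.
have lm_n n : (0 < n)%N -> (m n * l n <= n <= (m n).+1 * l n)%N.
  move=> n0; apply/andP; split; first by rewrite [leqRHS](n_eq n n0) leq_addr.
  by rewrite [leqLHS](n_eq n n0) mulSnr leq_add2l ltnW // r_lt.
have nu2_s2 : (s2 P Xf n)^-1 * nu2 P Xf (l n) (m n) @[n --> \oo] --> (1 : R).
  apply: cvg_eq_near var_sum; near=> n.
  have n0 : (0 < n)%N by near: n; exact: nbhs_infty_gt.
  have l0 : (0 : R) < (l n)%:R by rewrite ltr0n l_gt0.
  rewrite (mulrC (l n)%:R) -mulrA; congr (_ * _).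
  rewrite /nu2 mulr_sumr; apply: eq_bigr => j _.
  have B2 : block Xf (l n) j \in Lfun P 2%:E by apply: L2B; exact: L2_psum.
  rewrite (_ : (fun w => _) = fun w => (Num.sqrt (l n)%:R)^-1 * block Xf (l n) j w).
    by rewrite VarZ // exprVn sqr_sqrtr ?(ltW l0) // mulVKf // gt_eqF.
  by apply/funext => w; rewrite mulrC.
have clt := block_clt X_assoc X_L2 X0 s_gt0 lm_n nu2_s2.
split; last exact: clt.
apply: (iff_trans clt); apply: iff_sym.
exact: (block_lindeberg_nu_s X_assoc X_L2 s_gt0 lm_n nu2_s2).
Unshelve. all: by end_near. Qed.
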